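(* Let $c_0\in\mathbb{R}$ and let $\gamma_0:S^1=\mathbb{R}/2\pi\mathbb{Z}\to su(2)\simeq\mathbb{R}^3$ be a smooth closed curve parametrized by arc-length with normal holonomy $R(-2\pi c_0)$. Let $h_0$ be a periodic $h$-frame along $\gamma_0$ with $$h_0^{-1}(h_0)_x=\begin{pmatrix} 0 & -r_1^0 & -r_2^0 \\ {r_1^0} & 0 & -c_0 \\ {r_2^0} & c_0 & 0 \end{pmatrix}.$$ Let $\phi_0\in SU(2)$ be such that $\mathrm{Ad}(\phi_0)[\delta]=h_0(0)$. Assume that $q(x,t)$ is a smooth solution of the NLS $q_t=\frac{i}{2}(q_{xx}+2|q|^2q)$ on $\mathbb R^2$, periodic in $x$ with period $2\pi$, with $q(\cdot,0)=\frac12(r_1^0+ir_2^0)$. Let $E(x,t,\lambda)$ be the frame of $q$ with $E(0,0,\lambda)=\phi_0$ for all $\lambda$, and let $\eta=\frac{\partial E}{\partial\lambda}E^{-1}\big|_{\lambda=c_0/2}$. Then $\gamma(x,t)=\eta(x-c_0t,t)+\gamma_0(0)$ is a solution of $\gamma_t=\frac12\gamma_x\times\gamma_{xx}$ with initial data $\gamma(\cdot,0)=\gamma_0$, and $\gamma(x,t)$ is periodic in $x$ (with period $2\pi$).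
   Context: Let $a=\mathrm{diag}(i,-i)$, $b=\begin{pmatrix} 0 & 1 \\ -1 & 0 \end{pmatrix}$, $c=\begin{pmatrix} 0 & i \\ i & 0 \end{pmatrix}$. Identify $su(2)$ with Euclidean $\mathbb{R}^3$ by $xa+yb+zc\mapsto(x,y,z)^t$; then the inner product is $-\frac12\mathrm{tr}(XY)$ and $X\times Y=\frac12[X,Y]$. Set $\delta=(a,-c,b)$, and $\mathrm{Ad}(\phi)[\delta]=(\phi a\phi^{-1},-\phi c\phi^{-1},\phi b\phi^{-1})\in SO(3)$ for $\phi\in SU(2)$. Let $R(s)=\begin{pmatrix} \cos s & -\sin s \\ \sin s & \cos s \end{pmatrix}$. A p-frame along an arc-length parametrized curve $\gamma_0$ is an orthonormal frame $(e_0,e_1,e_2)\in SO(3)$ with $e_0=(\gamma_0)_x$ and $(e_1,e_2)$ parallel for the induced normal connection. ''Normal holonomy $R(-2\pi c_0)$'' means $(e_0,e_1,e_2)(2\pi)=(e_0,e_1,e_2)(0)\,\mathrm{diag}(1,R(-2\pi c_0))$ for p-frames. A periodic $h$-frame along $\gamma_0$ is a frame $h_0(x)=(e_0,e_1,e_2)(x)\,\mathrm{diag}(1,R(c_0x))$ with $(e_0,e_1,e_2)$ a p-frame; it is $2\pi$-periodic and $h_0^{-1}(h_0)_x$ has the form displayed in the claim. For a solution $q$ of the NLS put $u=\begin{pmatrix} 0 & q \\ -\bar q & 0 \end{pmatrix}$, $Q_{-1}(u)=\frac{i}{2}\begin{pmatrix} -|q|^2 & q_x \\ \bar q_x & |q|^2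 \end{pmatrix}$. A frame of $q$ is an invertible-matrix-valued solution $E(x,t,\lambda)$ of $E^{-1}E_x=a\lambda+u$, $E^{-1}E_t=a\lambda^2+u\lambda+Q_{-1}(u)$ satisfying $E(x,t,\bar\lambda)^*E(x,t,\lambda)=I_2$. *)

(* Defs.v *)
From mathcomp Require Import all_boot all_order all_algebra.
From mathcomp Require Import complex.
From mathcomp Require Import all_classical all_reals all_analysis.
From mathcomp Require Import ring lra.
Set Implicit Arguments.
Unset Strict Implicit.
Unset Printing Implicit Defensive.
Import Order.TTheory GRing.Theory Num.Theory.
Import numFieldNormedType.Exports.
Local Open Scope ring_scope.
Local Open Scope complex_scope.
Local Open Scope classical_set_scope.
Local Open Scope sesquilinear_scope.

(* A point of the circle R/2piZ is a real number and a function on the circle  *)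
(* is a 2pi-periodic function. The library norm on matrices is the sup norm,   *)
(* so Euclidean notions on R^3 = 'cV[R]_3 go through [dot].                    *)

Definition mx_of_rows (T : zmodType) (m n : nat) (s : seq (seq T)) :
  'M[T]_(m, n) := \matrix_(i, j) nth 0 (nth [::] s i) j.

Section Euclidean.
Variable R : realType.

Definition vec3 (x y z : R) : 'cV[R]_3 := \col_i nth 0 [:: x; y; z] i.

Definition dot (u v : 'cV[R]_3) : R := \sum_i u i 0 * v i 0.

Definition i0 : 'I_3 := @Ordinal 3 0 isT.
Definition i1 : 'I_3 := @Ordinal 3 1 isT.
Definition i2 : 'I_3 := @Ordinal 3 2 isT.

Definition cross (u v : 'cV[R]_3) : 'cV[R]_3 :=
  vec3 (u i1 0 * v i2 0 - u i2 0 * v i1 0)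
       (u i2 0 * v i0 0 - u i0 0 * v i2 0)
       (u i0 0 * v i1 0 - u i1 0 * v i0 0).

Definition SO3 (A : 'M[R]_3) : Prop := A^T *m A = 1%:M /\ \det A = 1.

Definition rotation (s : R) : 'M[R]_2 :=
  mx_of_rows 2 2 [:: [:: cos s; - sin s]; [:: sin s; cos s]].

Definition diag1 (A : 'M[R]_2) : 'M[R]_3 :=
  block_mx (1%:M : 'M[R]_1) 0 0 A.

End Euclidean.

Section Su2.
Variable R : realType.

Definition mxa : 'M[R[i]]_2 := mx_of_rows 2 2 [:: [:: 'i%C; 0]; [:: 0; - 'i%C]].
Definition mxb : 'M[R[i]]_2 := mx_of_rows 2 2 [:: [:: 0; 1]; [:: - 1; 0]].
Definition mxc : 'M[R[i]]_2 := mx_of_rows 2 2 [:: [:: 0; 'i%C]; [:: 'i%C; 0]].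

Definition SU2 (A : 'M[R[i]]_2) : Prop := A \is unitarymx /\ \det A = 1.

Definition su2 (X : 'M[R[i]]_2) : Prop := X^t* = - X /\ \tr X = 0.

Definition su2_mx (v : 'cV[R]_3) : 'M[R[i]]_2 :=
  (v i0 0)%:C *: mxa + (v i1 0)%:C *: mxb + (v i2 0)%:C *: mxc.

(* The inverse of [su2_mx] on su(2); meaningless for other matrices. *)
Definition su2_coord (X : 'M[R[i]]_2) : 'cV[R]_3 :=
  vec3 (complex.Im (X 0 0)) (complex.Re (X 0 1)) (complex.Im (X 0 1)).

Definition delta (j : 'I_3) : 'M[R[i]]_2 := nth 0 [:: mxa; - mxc; mxb] j.

(* The columns are the R^3-coordinates of the three entries of Ad(phi)[delta]. *)
Definition Ad_delta (phi : 'M[R[i]]_2) : 'M[R]_3 :=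
  \matrix_(i, j) su2_coord (phi *m delta j *m invmx phi) i 0.

End Su2.

(* The identification of su(2) with R^3, its inner product and cross product. *)
Section Su2Identification.
Variable R : realType.

Lemma mx2P (X Y : 'M[R[i]]_2) :
  [/\ X 0 0 = Y 0 0, X 0 1 = Y 0 1, X 1 0 = Y 1 0 & X 1 1 = Y 1 1] -> X = Y.
Proof.
case=> e00 e01 e10 e11; apply/matrixP => i j.
case: (unliftP ord0 i) => [i'|] ->; case: (unliftP ord0 j) => [j'|] ->;
  by rewrite ?(ord1 i') ?(ord1 j') //= (_ : lift _ _ = 1) //; apply: val_inj.
Qed.

Lemma vec3_eta (v : 'cV[R]_3) : vec3 (v i0 0) (v i1 0) (v i2 0) = v.
Proof.
apply/colP => i; rewrite mxE.
by case: i => [[|[|[|[]]]]] //= Hi; congr (v _ 0); apply: val_inj.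
Qed.

Lemma su2_mxE (v : 'cV[R]_3) : su2_mx v =
  mx_of_rows 2 2
    [:: [:: 0 +i* v i0 0; v i1 0 +i* v i2 0];
        [:: (- v i1 0) +i* v i2 0; 0 +i* (- v i0 0)]].
Proof.
by apply: mx2P; rewrite !mxE /=; split;
  apply/eqP; rewrite eq_complex /=; apply/andP; split; apply/eqP; ring.
Qed.

Lemma su2_mx_su2 (v : 'cV[R]_3) : su2 (su2_mx v).
Proof.
rewrite su2_mxE; split.
  apply: mx2P; rewrite !mxE /=; split;
    by apply/eqP; rewrite eq_complex /= ?oppr0 ?opprK !eqxx.
rewrite /mxtrace !big_ord_recl big_ord0 !mxE /=.
by apply/eqP; rewrite eq_complex /=; apply/andP; split; apply/eqP; ring.
Qed.

Lemma su2_mxK : cancel (@su2_mx R) (@su2_coord R).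
Proof. by move=> v; rewrite /su2_coord su2_mxE !mxE /= vec3_eta. Qed.

Lemma su2_coordK (X : 'M[R[i]]_2) : su2 X -> su2_mx (su2_coord X) = X.
Proof.
case=> XJ; rewrite /mxtrace big_ord_recl big_ord1.
rewrite (_ : lift _ _ = 1); last exact: val_inj.
have XE i j : (X j i)^*%C = - X i j by move/matrixP/(_ i j): XJ; rewrite !mxE.
rewrite su2_mxE; move: (XE 0 0) (XE 1 0) (XE 1 1); rewrite -[ord0]/(0 : 'I_2).
rewrite /su2_coord; case E00: (X 0 0) => [x00 y00].
case E01: (X 0 1) => [x01 y01]; case E10: (X 1 0) => [x10 y10].
case E11: (X 1 1) => [x11 y11] [u1] [v1 v2] [w1] [t1 t2].
by apply: mx2P; rewrite !mxE /= E00 E01 E10 E11; split; congr Complex; lra.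
Qed.

Lemma dot_su2 (v w : 'cV[R]_3) :
  (dot v w)%:C = - 2^-1 * \tr (su2_mx v *m su2_mx w).
Proof.
have two : 2^-1 = (2^-1)%:C :> R[i] by rewrite fmorphV rmorph_nat.
rewrite -[v]vec3_eta -[w]vec3_eta !su2_mxE /mxtrace big_ord_recl big_ord1.
rewrite !mxE !big_ord_recl !big_ord0 /dot !big_ord_recl big_ord0 !mxE /= two.
by apply/eqP; rewrite eq_complex /=; apply/andP; split; apply/eqP; field.
Qed.

Lemma cross_su2 (v w : 'cV[R]_3) :
  su2_mx (cross v w) =
  2^-1 *: (su2_mx v *m su2_mx w - su2_mx w *m su2_mx v).
Proof.
have two : 2^-1 = (2^-1)%:C :> R[i] by rewrite fmorphV rmorph_nat.
rewrite !su2_mxE /cross two; apply: mx2P.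
rewrite !mxE !big_ord_recl !big_ord0 !mxE /=.
by split; apply/eqP; rewrite eq_complex /=; apply/andP; split; apply/eqP; field.
Qed.

End Su2Identification.

Section Curves.
Variable R : realType.

Definition smooth_curve (gamma : R -> 'cV[R]_3) : Prop :=
  forall n x, derivable (derive1n n gamma) x 1.

Definition arc_length_param (gamma : R -> 'cV[R]_3) : Prop :=
  forall x, dot (derive1 gamma x) (derive1 gamma x) = 1.

(* The induced normal connection: the part of the derivative of a field v      *)
(* along gamma that is orthogonal to the unit tangent of gamma.                *)
Definition normal_connection (gamma v : R -> 'cV[R]_3) (x : R) : 'cV[R]_3 :=
  derive1 v x - dot (derive1 v x) (derive1 gamma x) *: derive1 gamma x.

Definition p_frame (gamma : R -> 'cV[R]_3) (e : R -> 'M[R]_3) : Prop :=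
  [/\ forall x, derivable e x 1,
      forall x, SO3 (e x),
      forall x, col i0 (e x) = derive1 gamma x,
      forall x, normal_connection gamma (fun y => col i1 (e y)) x = 0
    & forall x, normal_connection gamma (fun y => col i2 (e y)) x = 0].

Definition normal_holonomy (gamma : R -> 'cV[R]_3) (A : 'M[R]_2) : Prop :=
  forall e, p_frame gamma e -> e (2 * pi) = e 0 *m diag1 A.

(* 2pi-periodicity of h is not part of the definition: it follows from         *)
(* [normal_holonomy gamma (rotation (- (2 * pi * c0)))].                       *)
Definition h_frame (gamma : R -> 'cV[R]_3) (c0 : R) (h : R -> 'M[R]_3) : Prop :=
  exists2 e, p_frame gamma e & forall x, h x = e x *m diag1 (rotation (c0 * x)).

Definition h_connection (c0 r1 r2 : R) : 'M[R]_3 :=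
  mx_of_rows 3 3 [:: [:: 0; - r1; - r2]; [:: r1; 0; - c0]; [:: r2; c0; 0]].

End Curves.

Section PartialDerivatives.
Variables (R : realType) (V : normedModType R).

Definition dx (f : R -> R -> V) (x t : R) : V := derive1 (fun y => f y t) x.
Definition dt (f : R -> R -> V) (x t : R) : V := derive1 (f x) t.

Definition derivable_x (f : R -> R -> V) : Prop :=
  forall x t, derivable (fun y => f y t) x 1.
Definition derivable_t (f : R -> R -> V) : Prop :=
  forall x t, derivable (f x) t 1.

(* C^n on R^2: all iterated partial derivatives up to order n exist and are    *)
(* jointly continuous.                                                         *)
Fixpoint C_n (n : nat) (f : R -> R -> V) : Prop :=
  continuous (fun p : R * R => f p.1 p.2) /\
  if n is m.+1 then
    [/\ derivable_x f, derivable_t f, C_n m (dx f) & C_n m (dt f)]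
  else True.

Definition smooth2 (f : R -> R -> V) : Prop := forall n, C_n n f.

End PartialDerivatives.

(* The library has no R-normed structure on R[i]: derivatives of complex       *)
(* functions of real variables are taken on real and imaginary parts.          *)
Section ComplexValued.
Variable R : realType.

Definition cderivable (f : R -> R[i]) (x : R) : Prop :=
  derivable (fun y => complex.Re (f y)) x 1 /\
  derivable (fun y => complex.Im (f y)) x 1.

Definition cderive (f : R -> R[i]) (x : R) : R[i] :=
  derive1 (fun y => complex.Re (f y)) x +i*
  derive1 (fun y => complex.Im (f y)) x.

Definition mxcderivable (F : R -> 'M[R[i]]_2) (x : R) : Prop :=
  forall i j, cderivable (fun y => F y i j) x.

Definition mxcderive (F : R -> 'M[R[i]]_2) (x : R) : 'M[R[i]]_2 :=
  \matrix_(i, j) cderive (fun y => F y i j) x.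

Definition csmooth2 (q : R -> R -> R[i]) : Prop :=
  smooth2 (fun x t => complex.Re (q x t) : R^o) /\
  smooth2 (fun x t => complex.Im (q x t) : R^o).

Definition cdx (q : R -> R -> R[i]) (x t : R) : R[i] :=
  cderive (fun y => q y t) x.
Definition cdt (q : R -> R -> R[i]) (x t : R) : R[i] := cderive (q x) t.

Definition NLS (q : R -> R -> R[i]) : Prop := forall x t,
  cdt q x t =
  'i%C / 2 * (cdx (cdx q) x t + 2 * `|q x t| ^+ 2 * q x t).

Definition mxu (q : R -> R -> R[i]) (x t : R) : 'M[R[i]]_2 :=
  mx_of_rows 2 2 [:: [:: 0; q x t]; [:: - (q x t)^*; 0]].

Definition mxQ (q : R -> R -> R[i]) (x t : R) : 'M[R[i]]_2 :=
  ('i%C / 2) *: mx_of_rows 2 2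
    [:: [:: - `|q x t| ^+ 2; cdx q x t]; [:: (cdx q x t)^*; `|q x t| ^+ 2]].

Definition NLS_frame (q : R -> R -> R[i]) (E : R -> R -> R[i] -> 'M[R[i]]_2) :
    Prop :=
  forall x t lam,
  [/\ E x t lam \in unitmx,
      mxcderivable (fun y => E y t lam) x,
      mxcderivable (fun s => E x s lam) t
    & [/\ invmx (E x t lam) *m mxcderive (fun y => E y t lam) x =
            lam *: mxa R + mxu q x t,
          invmx (E x t lam) *m mxcderive (fun s => E x s lam) t =
            lam ^+ 2 *: mxa R + lam *: mxu q x t + mxQ q x t
        & (E x t lam^*)^t* *m E x t lam = 1%:M]].

(* The derivative is the complex one: lam ranges over R[i]. *)
Definition eta (E : R -> R -> R[i] -> 'M[R[i]]_2) (lam : R[i]) (x t : R) :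
  'M[R[i]]_2 := derive1 (E x t) lam *m invmx (E x t lam).

Definition VFE (gamma : R -> R -> 'cV[R]_3) : Prop :=
  [/\ derivable_x gamma, derivable_x (dx gamma), derivable_t gamma
    & forall x t,
        dt gamma x t = 2^-1 *: cross (dx gamma x t) (dx (dx gamma) x t)].

End ComplexValued.

(* Main.v *)
Require Import Defs.
From mathcomp Require Import all_boot all_order all_algebra.
From mathcomp Require Import complex.
From mathcomp Require Import all_classical all_reals all_analysis.
From mathcomp Require Import ring lra.
Import Order.TTheory GRing.Theory Num.Theory.
Import numFieldNormedType.Exports.
Set Implicit Arguments.
Unset Strict Implicit.
Unset Printing Implicit Defensive.
Local Open Scope ring_scope.
Local Open Scope complex_scope.
Local Open Scope classical_set_scope.
Local Open Scope sesquilinear_scope.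

(** Write [l0 = c0 / 2], [E0 = E(., ., l0)] (unitary) and let [Ad g] be
    conjugation by [g].

    The ratio [G(eps) = E(l0 + eps) E0^*] satisfies linear equations of the form
    [G' = eps G (A + eps B)] along the [x]- and [t]-axes; a Gronwall-type bound
    then gives [G = 1 + eps D + o(eps)], where [D] changes along a segment by
    the integral of [A].  Hence [eta] exists, [eta_x = Ad(E0) a] and
    [eta_t = Ad(E0) (c0 a + u)], so that the Galilean shift [x - c0 t] cancels
    the term [c0 Ad(E0) a] and leaves [gamma_t = Ad(E0) u].

    The real frame [H = Ad(E0)[delta]] has antisymmetric connection matrices in
    [x] and in [t], so [F F'^T] is conserved for any two frames with the same
    connection.  Comparing [H(., 0)] with [h0] gives [gamma(., 0) = gamma0];
    comparing [H] with its translate by [2 pi] gives periodicity. *)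

(** * One-variable real calculus *)

(** Each fixed parameter gives [E] two linear equations, one in [x] and one in [t]; no regularity in
    [lam] is assumed, and no joint differentiability. Hence everything about [eta] is obtained along
    one axis at a time, starting from the origin, where [E] is constant in [lam] and the expansion
    of the ratio is exact.

    The parameter [c0 / 2] is real, so the unitarity condition applies to [E0] itself: its inverse
    is its adjoint, the part of the equation that does not depend on [eps] drops out of the ratio,
    and a factor [eps] remains. This factor makes the growth estimate hold on a whole segment for
    small [eps].

    Only the partial derivatives of [eta] are known, so the shift [x - c0 t] is not covered by a
    chain rule. It is treated with a local bound on [eta_xx], for which orthogonality of [H] and
    local boundedness of [q] are needed.

    The value [c0 / 2] comes from commutators being twice cross products: the [x]-connection of [H]
    then contains [2 (c0 / 2) = c0], as that of [h0] does. The drift [c0 a] in [eta_t] has the same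
    value for another reason: it is the derivative [2 lam a] of [lam^2 a] at [c0 / 2]. *)

Section RealCalculus.
Variable R : realType.
Implicit Types (f df : R -> R) (a b x y : R).

Lemma is_derive1_continuous f x d : is_derive x 1 f d -> {for x, continuous f}.
Proof.
by case=> df _; apply/differentiable_continuous/derivable1_diffP.
Qed.

Lemma mean_value_le f df a b (M : R) :
  (forall z, a <= z <= b -> is_derive z 1 f (df z)) ->
  (forall z, a <= z <= b -> `|df z| <= M) ->
  forall x y, a <= x <= b -> a <= y <= b -> `|f x - f y| <= M * `|x - y|.
Proof.
move=> fD dfM.
have main x y : a <= x -> x <= y -> y <= b -> `|f y - f x| <= M * `|y - x|.
  move=> ax xy yb.
  have [||c /[!in_itv]/= /andP[xc cy] ->] := @MVT_segment R f df x y xy.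
  - move=> z /[!in_itv]/= /andP[xz zy].
    by apply: fD; rewrite (le_trans ax (ltW xz)) (le_trans (ltW zy) yb).
  - apply: derivable_within_continuous => z /[!in_itv]/= /andP[xz zy].
    by case: (fD z) => //; rewrite (le_trans ax xz) (le_trans zy yb).
  rewrite normrM ler_wpM2r// dfM//.
  by rewrite (le_trans ax xc) (le_trans cy yb).
move=> x y /andP[ax xb] /andP[ay yb]; case: (leP x y) => [xy|/ltW yx].
  by rewrite distrC (distrC x); exact: main.
exact: main.
Qed.

Lemma continuous_primitive f a b : continuous f ->
  exists P : R -> R, forall x, a < x < b -> is_derive x 1 P (f x).
Proof.
move=> cf.
exists (fun x => \int[@lebesgue_measure R]_(t in `[a, x]) f t) => x /andP[ax xb].
have fi : (@lebesgue_measure R).-integrable `[a, b] (EFin \o f).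
  apply: continuous_compact_integrable; first exact: segment_compact.
  exact: continuous_subspaceT.
have [dF eF] := continuous_FTC1_closed xb fi ax (cf x).
by apply: (DeriveDef dF); rewrite -derive1E.
Qed.

Lemma continuous_bounded f a b : continuous f ->
  exists M : R, forall x, a <= x <= b -> `|f x| <= M.
Proof.
move=> cf; case: (leP a b) => [ab|ba]; last first.
  exists 0 => x /andP[ax xb].
  by move: (le_lt_trans (le_trans ax xb) ba); rewrite ltxx.
have [|c _ fc] := @EVT_max R (fun x => `|f x|) a b ab.
  apply: continuous_subspaceT => x.
  apply: (@continuous_comp _ _ _ f Num.norm); first exact: cf.
  exact: norm_continuous.
by exists `|f c| => x xab; apply: fc; rewrite in_itv.
Qed.

End RealCalculus.

(** * Complex matrix functions of a real variable *)

Section ComplexDerivative.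
Variable R : realType.
Implicit Types (f g : R -> R[i]) (x : R).

(** Derivability and value are kept in one predicate, so that the calculus rules compose without
    side conditions. *)
Definition is_cderive f x (d : R[i]) : Prop :=
  is_derive x 1 (fun y => complex.Re (f y)) (complex.Re d) /\
  is_derive x 1 (fun y => complex.Im (f y)) (complex.Im d).

Lemma is_cderive_cst (z : R[i]) x : is_cderive (fun=> z) x 0.
Proof. by split; exact: is_derive_cst. Qed.

Lemma is_cderiveD f g x df dg : is_cderive f x df -> is_cderive g x dg ->
  is_cderive (fun y => f y + g y) x (df + dg).
Proof.
move=> [fR fI] [gR gI]; split; rewrite raddfD.
  rewrite (_ : (fun y => _) =
    (fun y => complex.Re (f y)) + (fun y => complex.Re (g y))).
    exact: is_deriveD.
  by apply/funext => y; rewrite raddfD.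
rewrite (_ : (fun y => _) =
  (fun y => complex.Im (f y)) + (fun y => complex.Im (g y))).
  exact: is_deriveD.
by apply/funext => y; rewrite raddfD.
Qed.

Lemma is_cderiveM f g x df dg : is_cderive f x df -> is_cderive g x dg ->
  is_cderive (fun y => f y * g y) x (df * g x + f x * dg).
Proof.
move=> [fR fI] [gR gI]; split.
  rewrite (_ : (fun y => _) =
    (fun y => complex.Re (f y)) * (fun y => complex.Re (g y)) -
    (fun y => complex.Im (f y)) * (fun y => complex.Im (g y))).
    apply: (is_derive_eq (is_deriveB (is_deriveM fR gR) (is_deriveM fI gI))).
    case: (f x) (g x) df dg {fR fI gR gI} => [a b] [c d] [a' b'] [c' d'] /=.
    by rewrite /GRing.scale /=; ring.
  by apply/funext => y; rewrite !fctE; case: (f y) (g y) => [? ?] [].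
rewrite (_ : (fun y => _) =
  (fun y => complex.Re (f y)) * (fun y => complex.Im (g y)) +
  (fun y => complex.Im (f y)) * (fun y => complex.Re (g y))).
  apply: (is_derive_eq (is_deriveD (is_deriveM fR gI) (is_deriveM fI gR))).
  case: (f x) (g x) df dg {fR fI gR gI} => [a b] [c d] [a' b'] [c' d'] /=.
  by rewrite /GRing.scale /=; ring.
by apply/funext => y; rewrite !fctE; case: (f y) (g y) => [? ?] [].
Qed.

Lemma is_cderive_conj f x df : is_cderive f x df ->
  is_cderive (fun y => (f y)^*%C) x df^*%C.
Proof.
move=> [fR fI]; split.
  rewrite (_ : (fun y => _) = (fun y => complex.Re (f y))); last first.
    by apply/funext => y; case: (f y).
  by case: df {fI} fR.
rewrite (_ : (fun y => _) = - (fun y => complex.Im (f y))); last first.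
  by apply/funext => y; rewrite fctE; case: (f y).
rewrite (_ : complex.Im df^*%C = - complex.Im df); last by case: df {fR fI}.
exact: is_deriveN.
Qed.

Lemma is_cderive_sum (I : Type) (r : seq I) (F : I -> R -> R[i])
    (D : I -> R[i]) x : (forall k, is_cderive (F k) x (D k)) ->
  is_cderive (fun y => \sum_(k <- r) F k y) x (\sum_(k <- r) D k).
Proof.
move=> FD; elim: r => [|k r IHr].
  rewrite big_nil (_ : (fun y => _) = fun=> 0); first exact: is_cderive_cst.
  by apply/funext => y; rewrite big_nil.
rewrite big_cons (_ : (fun y => _) = fun y => F k y + \sum_(k <- r) F k y).
  exact: is_cderiveD.
by apply/funext => y; rewrite big_cons.
Qed.

Definition is_mxderive m n (F : R -> 'M[R[i]]_(m, n)) x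
    (D : 'M[R[i]]_(m, n)) : Prop :=
  forall i j, is_cderive (fun y => F y i j) x (D i j).

Lemma is_mxderive_cst m n (A : 'M[R[i]]_(m, n)) x : is_mxderive (fun=> A) x 0.
Proof. by move=> i j; rewrite mxE; exact: is_cderive_cst. Qed.

Lemma is_mxderiveD m n (F G : R -> 'M[R[i]]_(m, n)) x dF dG :
  is_mxderive F x dF -> is_mxderive G x dG ->
  is_mxderive (fun y => F y + G y) x (dF + dG).
Proof.
move=> FD GD i j; rewrite mxE (_ : (fun y => _) = fun y => F y i j + G y i j).
  exact: is_cderiveD.
by apply/funext => y; rewrite mxE.
Qed.

Lemma is_mxderiveM m n p (F : R -> 'M[R[i]]_(m, n)) (G : R -> 'M[R[i]]_(n, p))
    x dF dG : is_mxderive F x dF -> is_mxderive G x dG ->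
  is_mxderive (fun y => F y *m G y) x (dF *m G x + F x *m dG).
Proof.
move=> FD GD i j; rewrite !mxE -big_split /=.
rewrite (_ : (fun y => _) = fun y => \sum_k F y i k * G y k j); last first.
  by apply/funext => y; rewrite mxE.
by apply: is_cderive_sum => k; exact: is_cderiveM.
Qed.

Lemma is_mxderiveMl m n p (A : 'M[R[i]]_(m, n)) (F : R -> 'M[R[i]]_(n, p)) x dF :
  is_mxderive F x dF -> is_mxderive (fun y => A *m F y) x (A *m dF).
Proof.
move=> FD; have := is_mxderiveM (is_mxderive_cst A x) FD.
by rewrite mul0mx add0r.
Qed.

Lemma is_mxderiveMr m n p (A : 'M[R[i]]_(n, p)) (F : R -> 'M[R[i]]_(m, n)) x dF :
  is_mxderive F x dF -> is_mxderive (fun y => F y *m A) x (dF *m A).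
Proof.
move=> FD; have := is_mxderiveM FD (is_mxderive_cst A x).
by rewrite mulmx0 addr0.
Qed.

Lemma is_mxderiveB m n (F G : R -> 'M[R[i]]_(m, n)) x dF dG :
  is_mxderive F x dF -> is_mxderive G x dG ->
  is_mxderive (fun y => F y - G y) x (dF - dG).
Proof.
move=> FD GD; apply: is_mxderiveD => // i j.
have := is_mxderiveMr (- 1%:M) GD i j.
rewrite mulmxN mulmx1 (_ : (fun y => _) = fun y => (- G y) i j) //.
by apply/funext => y; rewrite mulmxN mulmx1.
Qed.

Lemma is_mxderive_adj m n (F : R -> 'M[R[i]]_(m, n)) x dF :
  is_mxderive F x dF -> is_mxderive (fun y => (F y)^t*) x (dF^t*).
Proof.
move=> FD i j; rewrite !mxE (_ : (fun y => _) = fun y => (F y j i)^*%C).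
  exact: is_cderive_conj.
by apply/funext => y; rewrite !mxE.
Qed.

Lemma is_mxderive_tr n (F : R -> 'M[R[i]]_n) x dF :
  is_mxderive F x dF -> is_cderive (fun y => \tr (F y)) x (\tr dF).
Proof. by move=> FD; apply: is_cderive_sum => k; exact: FD. Qed.

Lemma is_cderive_0_cst f : (forall x, is_cderive f x 0) -> forall x y, f x = f y.
Proof.
move=> f0 x y; apply/eqP; rewrite eq_complex; apply/andP; split; apply/eqP.
  apply: (@is_derive_0_is_cst _ (fun s => complex.Re (f s))) => z.
  by case: (f0 z).
apply: (@is_derive_0_is_cst _ (fun s => complex.Im (f s))) => z.
by case: (f0 z).
Qed.

Lemma is_mxderive_0_cst m n (F : R -> 'M[R[i]]_(m, n)) :
  (forall x, is_mxderive F x 0) -> forall x y, F x = F y.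
Proof.
move=> F0 x y; apply/matrixP => i j; apply: (@is_cderive_0_cst (fun s => F s i j)) => z.
by have := F0 z i j; rewrite mxE.
Qed.

Lemma mxcderivableP (F : R -> 'M[R[i]]_2) x :
  mxcderivable F x -> is_mxderive F x (mxcderive F x).
Proof.
move=> FD i j; case: (FD i j) => dR dI; rewrite mxE; split => /=.
  by apply: (DeriveDef dR); rewrite derive1E.
by apply: (DeriveDef dI); rewrite derive1E.
Qed.

End ComplexDerivative.

(** * Entrywise norms and the mean value inequality for complex matrices *)

Section EntrywiseNorm.
Variable R : realType.
Implicit Types (z w : R[i]).

(** The l1 norm of the pair of real and imaginary parts: real valued, submultiplicative, and a sum
    of components to which the real mean value inequality applies. *)
Definition cnorm1 z : R := `|complex.Re z| + `|complex.Im z|.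

Lemma cnorm1_ge0 z : 0 <= cnorm1 z. Proof. exact: addr_ge0. Qed.

Lemma cnorm1D z w : cnorm1 (z + w) <= cnorm1 z + cnorm1 w.
Proof.
rewrite /cnorm1 !raddfD addrACA.
by apply: lerD; exact: ler_normD.
Qed.

Lemma cnorm1N z : cnorm1 (- z) = cnorm1 z.
Proof. by rewrite /cnorm1 !raddfN !normrN. Qed.

Lemma cnorm1M z w : cnorm1 (z * w) <= cnorm1 z * cnorm1 w.
Proof.
case: z w => [a b] [c d]; rewrite /cnorm1 /= mulrDl !mulrDr -!normrM.
have := ler_normB (a * c) (b * d); have := ler_normD (a * d) (b * c); lra.
Qed.

Lemma cnorm1_sum (I : Type) (r : seq I) (F : I -> R[i]) :
  cnorm1 (\sum_(k <- r) F k) <= \sum_(k <- r) cnorm1 (F k).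
Proof.
elim/big_rec2: _ => [|k y z _ IH]; first by rewrite /cnorm1 normr0 addr0.
by apply: le_trans (cnorm1D _ _) _; rewrite lerD2l.
Qed.

Definition mxnorm1 m n (A : 'M[R[i]]_(m, n)) : R :=
  \sum_i \sum_j cnorm1 (A i j).

Lemma mxnorm1_ge0 m n (A : 'M[R[i]]_(m, n)) : 0 <= mxnorm1 A.
Proof. by do 2![apply: sumr_ge0 => ? _]; exact: cnorm1_ge0. Qed.

Lemma cnorm1_le_mxnorm1 m n (A : 'M[R[i]]_(m, n)) i j : cnorm1 (A i j) <= mxnorm1 A.
Proof.
rewrite /mxnorm1 (bigD1 i)//= (bigD1 j)//= -addrA lerDl addr_ge0//.
  by apply: sumr_ge0 => ? _; exact: cnorm1_ge0.
by do 2![apply: sumr_ge0 => ? _]; exact: cnorm1_ge0.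
Qed.

Lemma mxnorm1D m n (A B : 'M[R[i]]_(m, n)) : mxnorm1 (A + B) <= mxnorm1 A + mxnorm1 B.
Proof.
rewrite /mxnorm1 -big_split; apply: ler_sum => i _ /=.
rewrite -big_split; apply: ler_sum => j _ /=.
by rewrite mxE cnorm1D.
Qed.

Lemma mxnorm1N m n (A : 'M[R[i]]_(m, n)) : mxnorm1 (- A) = mxnorm1 A.
Proof.
by apply: eq_bigr => i _; apply: eq_bigr => j _; rewrite mxE cnorm1N.
Qed.

Lemma mxnorm1Z m n z (A : 'M[R[i]]_(m, n)) : mxnorm1 (z *: A) <= cnorm1 z * mxnorm1 A.
Proof.
rewrite mulr_sumr; apply: ler_sum => i _; rewrite mulr_sumr.
by apply: ler_sum => j _; rewrite mxE cnorm1M.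
Qed.

Lemma mxnorm1M m n p (A : 'M[R[i]]_(m, n)) (B : 'M[R[i]]_(n, p)) :
  mxnorm1 (A *m B) <= mxnorm1 A * mxnorm1 B.
Proof.
rewrite {1}/mxnorm1 mulr_suml; apply: ler_sum => i _.
rewrite [mxnorm1 B]exchange_big mulr_sumr; apply: ler_sum => j _.
rewrite mxE; apply: le_trans (cnorm1_sum _ _) _.
rewrite mulr_suml; apply: ler_sum => k _.
apply: le_trans (cnorm1M _ _) _; apply: ler_wpM2l; first exact: cnorm1_ge0.
rewrite (bigD1 k)//= lerDl; apply: sumr_ge0 => ? _; exact: cnorm1_ge0.
Qed.

Lemma mxnorm1_continuous m n (F : R -> 'M[R[i]]_(m, n)) :
  (forall i j, continuous (fun s => complex.Re (F s i j)) /\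
    continuous (fun s => complex.Im (F s i j))) ->
  continuous (fun s => mxnorm1 (F s)).
Proof.
move=> cF s; rewrite /mxnorm1.
apply: cvg_big => [|i _]; first exact: add_continuous.
apply: cvg_big => [|j _]; first exact: add_continuous.
by have [cR cI] := cF i j; apply: cvgD; apply: cvg_norm; [exact: cR|exact: cI].
Qed.

(** Each of the [m * n * 2] real components satisfies the scalar inequality with the same bound [M];
    the constant only counts them. *)
Lemma mx_mean_value_le m n (F dF : R -> 'M[R[i]]_(m, n)) (a b M : R) :
  (forall s : R, a <= s <= b -> is_mxderive F s (dF s)) ->
  (forall s : R, a <= s <= b -> mxnorm1 (dF s) <= M) ->
  forall x y, a <= x <= b -> a <= y <= b ->
  mxnorm1 (F x - F y) <= (m * n * 2)%:R * M * `|x - y|.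
Proof.
move=> FD FM x y xab yab.
rewrite natrM -!mulrA natrM -mulrA mulr_natl -[m in leRHS]card_ord -sumr_const.
apply: ler_sum => i _; rewrite mulr_natl -[n in leRHS]card_ord -sumr_const.
apply: ler_sum => j _; rewrite mulr2n mulrDl mul1r.
have bound (s : R) : a <= s <= b -> cnorm1 (dF s i j) <= M.
  by move=> sab; exact: le_trans (cnorm1_le_mxnorm1 _ _ _) (FM s sab).
rewrite /cnorm1 !mxE !raddfB lerD//.
  apply: (@mean_value_le _ (fun s => complex.Re (F s i j))
    (fun s => complex.Re (dF s i j)) a b) => // s sab.
    by case: (FD s sab i j).
  by apply: le_trans (bound s sab); rewrite lerDl.
apply: (@mean_value_le _ (fun s => complex.Im (F s i j))
  (fun s => complex.Im (dF s i j)) a b) => // s sab.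
  by case: (FD s sab i j).
by apply: le_trans (bound s sab); rewrite lerDr.
Qed.

End EntrywiseNorm.

(** * Dependence of a linear equation on its parameter *)

Section ParameterDependence.
Variable R : realType.

Ltac nonneg := repeat first
  [ done | by rewrite subr_ge0 | exact: mxnorm1_ge0 | exact: ler0n
  | apply: addr_ge0 | apply: mulr_ge0 ].

Lemma small_mul_le (K e : R) : 0 <= K -> 0 < e ->
  exists2 d : R, 0 < d & forall x, x < d -> K * x <= e.
Proof.
(* Dividing by [K + 1] covers the case [K = 0]; for negative [x] the bound is trivial. *)
move=> K0 e0; exists (e / (K + 1)) => [|x xd]; first by apply: divr_gt0 => //; lra.
have K1 : 0 < K + 1 by lra.
move: xd; rewrite ltr_pdivlMr// => xd.
case: (leP 0 x) => [x0|x0]; first by lra.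
by have : K * x <= 0 by [rewrite mulr_ge0_le0// ltW]; lra.
Qed.

(* If [m] is the maximum of [|F|] on [[a, b]], then the mean value inequality
   between [s0] and a point where it is attained gives [m <= |F s0| + m / 2]. *)
Lemma linear_ode_growth n (F V : R -> 'M[R[i]]_n) (a b kappa : R) :
  (forall s, is_mxderive F s (F s *m V s)) ->
  (forall s, a <= s <= b -> mxnorm1 (V s) <= kappa) ->
  2 * (n * n * 2)%:R * kappa * (b - a) <= 1 ->
  forall s0 s, a <= s0 <= b -> a <= s <= b -> mxnorm1 (F s) <= 2 * mxnorm1 (F s0).
Proof.
move=> FD Vk small s0 s s0ab sab.
have ab : a <= b by case/andP: sab => /le_trans; exact.
have cF : continuous (fun s => mxnorm1 (F s)).
  apply: mxnorm1_continuous => i j; split => x; case: (FD x i j) => dR dI.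
    exact: (is_derive1_continuous dR).
  exact: (is_derive1_continuous dI).
have [|c cab Fc] := @EVT_max R (fun s => mxnorm1 (F s)) a b ab.
  exact: continuous_subspaceT.
have Fle x : a <= x <= b -> mxnorm1 (F x) <= mxnorm1 (F c).
  by move=> xab; apply: Fc; rewrite in_itv.
have dF x : a <= x <= b -> mxnorm1 (F x *m V x) <= mxnorm1 (F c) * kappa.
  move=> xab; apply: le_trans (mxnorm1M _ _) _.
  by apply: ler_pM => //; [exact: mxnorm1_ge0|exact: mxnorm1_ge0|exact: Fle|exact: Vk].
have {}cab : a <= c <= b by move: cab; rewrite in_itv.
have := mx_mean_value_le (fun x _ => FD x) dF cab s0ab.
set k := (n * n * 2)%:R in small * => step.
have k0 : 0 <= k :> R by exact: ler0n.
have kappa0 : 0 <= kappa by exact: le_trans (mxnorm1_ge0 _) (Vk s sab).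
have m0 := mxnorm1_ge0 (F c).
have dist : `|c - s0| <= b - a.
  by rewrite ler_norml; move: cab s0ab => /andP[? ?] /andP[? ?]; apply/andP; split; lra.
have {}step : mxnorm1 (F c - F s0) <= mxnorm1 (F c) / 2.
  apply: le_trans step _.
  apply: (@le_trans _ _ (k * (mxnorm1 (F c) * kappa) * (b - a))).
    by apply: ler_wpM2l => //; nonneg.
  have := ler_wpM2l m0 small; lra.
have := mxnorm1D (F c - F s0) (F s0); rewrite subrK.
have := Fle s sab; lra.
Qed.

(** Complex differentiability at 0 with derivative [N]; the case [eps = 0] forces [g 0 = A]. All
    estimates stay real. *)
Definition expands0 n (g : R[i] -> 'M[R[i]]_n) (A N : 'M[R[i]]_n) : Prop :=
  forall e : R, 0 < e -> exists2 d : R, 0 < d & forall eps : R[i],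
    cnorm1 eps < d -> mxnorm1 (g eps - A - eps *: N) <= e * cnorm1 eps.

(** The equation keeps [G] within [O(eps)] of its value at [s0], so integrating it changes [G] by
    [eps] times the integral of [A], up to [O(eps^2)]. The primitive [P] stands for that
    integral. *)
Lemma expands0_transport n (G : R[i] -> R -> 'M[R[i]]_n) (A B P : R -> 'M[R[i]]_n)
    (N : 'M[R[i]]_n) (a b C s0 s1 : R) :
  (forall eps s, is_mxderive (G eps) s (eps *: (G eps s *m (A s + eps *: B s)))) ->
  (forall s, a <= s <= b -> is_mxderive P s (A s)) ->
  (forall s, a <= s <= b -> mxnorm1 (A s) <= C) ->
  (forall s, a <= s <= b -> mxnorm1 (B s) <= C) ->
  a <= s0 <= b -> a <= s1 <= b ->
  expands0 (G ^~ s0) 1%:M N -> expands0 (G ^~ s1) 1%:M (N + (P s1 - P s0)).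
Proof.
move=> GD PD AC BC s0ab s1ab N0.
have C0 : 0 <= C by exact: le_trans (mxnorm1_ge0 _) (AC s0 s0ab).
have ab : a <= b by case/andP: s0ab => /le_trans; exact.
have dist s : a <= s <= b -> `|s - s0| <= b - a.
  move=> /andP[? ?]; rewrite ler_norml.
  by move: s0ab => /andP[? ?]; apply/andP; split; lra.
pose k : R := (n * n * 2)%:R.
have k0 : 0 <= k by exact: ler0n.
(* [m] bounds [G] on the segment; its summand 1 is the tolerance used for [d1]. [K1] is the rate at
   which [G eps s] leaves [G eps s0], [K2] the quadratic rate of the derivative of [F] below, and
   [K3] collects all second-order errors. *)
pose m := 2 * (mxnorm1 (1%:M : 'M[R[i]]_n) + mxnorm1 N + 1).
have m0 : 0 <= m by rewrite /m; nonneg.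
pose K1 := k * (m * (2 * C)) * (b - a).
have K10 : 0 <= K1 by rewrite /K1; nonneg.
pose K2 := K1 * C + m * C.
have K20 : 0 <= K2 by rewrite /K2; nonneg.
pose K3 := k * K2 * (b - a) + (mxnorm1 N + 1) * mxnorm1 (P s1 - P s0).
have K30 : 0 <= K3 by rewrite /K3; nonneg.
move=> e e0.
have [d1 d10 Hd1] := N0 1 ltr01.
have e20 : 0 < e / 2 by rewrite divr_gt0.
have [d2 d20 Hd2] := N0 _ e20.
have small0 : 0 <= 2 * k * (2 * C) * (b - a) by nonneg.
have [d3 d30 Hd3] := small_mul_le small0 ltr01.
have [d4 d40 Hd4] := small_mul_le K30 e20.
exists (Num.min 1 (Num.min (Num.min d1 d2) (Num.min d3 d4))).
  by rewrite !lt_min ltr01 d10 d20 d30 d40.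
move=> eps; rewrite !lt_min => /and3P[eps1 /andP[epsd1 epsd2] /andP[epsd3 epsd4]].
have eps0 := cnorm1_ge0 eps.
set x := cnorm1 eps in eps0 eps1 epsd1 epsd2 epsd3 epsd4 *.
have {Hd1} G0 := Hd1 _ epsd1; have {Hd2} G0' := Hd2 _ epsd2.
rewrite -/x in G0 G0'.
have {Hd3} small := Hd3 _ epsd3; have {Hd4} K3x := Hd4 _ epsd4.
have G01 : mxnorm1 (G eps s0 - 1%:M) <= x * (mxnorm1 N + 1).
  rewrite -[G eps s0 - 1%:M](subrK (eps *: N)).
  apply: le_trans (mxnorm1D _ _) _.
  by have := mxnorm1Z eps N; rewrite -/x; lra.
have Gs0m : 2 * mxnorm1 (G eps s0) <= m.
  have := mxnorm1D (G eps s0 - 1%:M) 1%:M; rewrite subrK /m.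
  have : x * (mxnorm1 N + 1) <= 1 * (mxnorm1 N + 1).
    by apply: ler_wpM2r (ltW eps1); nonneg.
  lra.
pose V s := eps *: (A s + eps *: B s).
have GV s : is_mxderive (G eps) s (G eps s *m V s).
  by rewrite /V -scalemxAr; exact: GD.
have Vk s : a <= s <= b -> mxnorm1 (V s) <= x * (2 * C).
  move=> sab; apply: le_trans (mxnorm1Z _ _) _; rewrite -/x ler_wpM2l//.
  have := mxnorm1D (A s) (eps *: B s); have := mxnorm1Z eps (B s); rewrite -/x.
  have := AC s sab; have := ler_pM eps0 (mxnorm1_ge0 (B s)) (ltW eps1) (BC s sab).
  lra.
have Gm s : a <= s <= b -> mxnorm1 (G eps s) <= m.
  move=> sab; apply: le_trans Gs0m.
  apply: (linear_ode_growth GV Vk) => //.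
  by rewrite -/k; move: small; lra.
have GK1 s : a <= s <= b -> mxnorm1 (G eps s - G eps s0) <= K1 * x.
  move=> sab.
  have dG z : a <= z <= b -> mxnorm1 (G eps z *m V z) <= m * (x * (2 * C)).
    move=> zab; apply: le_trans (mxnorm1M _ _) _.
    by apply: ler_pM; rewrite ?mxnorm1_ge0 ?Gm ?Vk.
  apply: le_trans (mx_mean_value_le (fun z _ => GV z) dG sab s0ab) _.
  rewrite -/k (_ : K1 * x = k * (m * (x * (2 * C))) * (b - a)); last by rewrite /K1; ring.
  by apply: ler_wpM2l (dist _ _) => //; nonneg.
(* Freezing [G] at [s0] in the main term leaves a derivative of second order: by [GK1], replacing
   [G eps s] by [G eps s0] gains one more factor [cnorm1 eps]. *)
pose F s := G eps s - (eps *: G eps s0) *m P s.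
pose dF s := eps *: ((G eps s - G eps s0) *m A s + eps *: (G eps s *m B s)).
have FD s : a <= s <= b -> is_mxderive F s (dF s).
  move=> sab.
  have -> : dF s = G eps s *m V s - (eps *: G eps s0) *m A s.
    rewrite /dF /V mulmxBl -scalemxAl -scalemxAr mulmxDr -scalemxAr -scalerBr.
    by congr (_ *: _); rewrite addrAC.
  by apply: is_mxderiveB => //; apply: is_mxderiveMl; exact: PD.
have FK2 s : a <= s <= b -> mxnorm1 (dF s) <= x * (x * K2).
  move=> sab; apply: le_trans (mxnorm1Z _ _) _; rewrite -/x ler_wpM2l//.
  apply: le_trans (mxnorm1D _ _) _.
  have := mxnorm1Z eps (G eps s *m B s); rewrite -/x.
  have := le_trans (mxnorm1M _ _) (ler_pM (mxnorm1_ge0 _) (mxnorm1_ge0 _) (GK1 s sab) (AC s sab)).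
  have := ler_wpM2l eps0 (le_trans (mxnorm1M _ _)
    (ler_pM (mxnorm1_ge0 _) (mxnorm1_ge0 _) (Gm s sab) (BC s sab))).
  by rewrite /K2; lra.
have step := mx_mean_value_le FD FK2 s1ab s0ab.
have {step} Fstep : mxnorm1 (F s1 - F s0) <= k * K2 * (b - a) * x * x.
  apply: le_trans step _; rewrite -/k.
  apply: (@le_trans _ _ (k * (x * (x * K2)) * (b - a))).
    by apply: ler_wpM2l (dist _ _) => //; nonneg.
  by lra.
(* The three terms are the change of [F], the expansion error at [s0], and the replacement of
   [G eps s0] by the identity. The outer two are of second order and share one half of [e]; the
   middle one takes the other half. *)
have -> : G eps s1 - 1%:M - eps *: (N + (P s1 - P s0)) =
    (F s1 - F s0) + (G eps s0 - 1%:M - eps *: N) +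
    eps *: ((G eps s0 - 1%:M) *m (P s1 - P s0)).
  rewrite /F scalerDr mulmxBl mul1mx scalerBr.
  rewrite opprB -(scalemxAl eps (G eps s0) (P s1)) -(scalemxAl eps (G eps s0) (P s0)).
  rewrite (mulmxBr (G eps s0)) scalerBr.
  by apply/matrixP => i j; rewrite !mxE; ring.
apply: le_trans (mxnorm1D _ _) _.
have H1 := mxnorm1D (F s1 - F s0) (G eps s0 - 1%:M - eps *: N).
have H2 := mxnorm1Z eps ((G eps s0 - 1%:M) *m (P s1 - P s0)).
have H3 := mxnorm1M (G eps s0 - 1%:M) (P s1 - P s0).
have H4 := ler_wpM2r (mxnorm1_ge0 (P s1 - P s0)) G01.
have H5 := ler_wpM2l eps0 (le_trans H3 H4).
rewrite -/x in H2.
have H6 := ler_wpM2r eps0 K3x.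
rewrite /K3 in H6; lra.
Qed.

End ParameterDependence.

(** * Parameter derivative of a unitary frame along one axis *)

Section FrameParameter.
Variable R : realType.

Lemma is_mxderive_near m n (F G : R -> 'M[R[i]]_(m, n)) x D :
  (\near x, F x = G x) -> is_mxderive F x D -> is_mxderive G x D.
Proof.
move=> FG FD i j; have [dR dI] := FD i j; split.
  by apply: near_eq_is_derive dR; apply: filterS FG => y /= ->.
by apply: near_eq_is_derive dI; apply: filterS FG => y /= ->.
Qed.

Lemma is_mxderive_primitive m n (A : R -> 'M[R[i]]_(m, n)) a b :
  (forall i j, continuous (fun s => complex.Re (A s i j)) /\
    continuous (fun s => complex.Im (A s i j))) ->
  exists P : R -> 'M[R[i]]_(m, n), forall s, a <= s <= b -> is_mxderive P s (A s).
Proof.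
move=> cA.
(* A primitive is obtained with its derivative only in the interior, so the interval is enlarged by
   1 on both sides. *)
have cRe i j := continuous_primitive (a - 1) (b + 1) (cA i j).1.
have cIm i j := continuous_primitive (a - 1) (b + 1) (cA i j).2.
exists (fun s => \matrix_(i, j) (sval (cid (cRe i j)) s +i* sval (cid (cIm i j)) s)).
move=> s /andP[as_ sb] i j.
have sab : a - 1 < s < b + 1 by apply/andP; split; lra.
split.
  rewrite (_ : (fun y => _) = sval (cid (cRe i j))).
    exact: (svalP (cid (cRe i j))).
  by apply/funext => y; rewrite mxE.
rewrite (_ : (fun y => _) = sval (cid (cIm i j))).
  exact: (svalP (cid (cIm i j))).
by apply/funext => y; rewrite mxE.
Qed.

Lemma expands0_unique n (g : R[i] -> 'M[R[i]]_n) A N N' :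
  expands0 g A N -> expands0 g A N' -> N = N'.
Proof.
move=> gN gN'; apply/eqP; rewrite -subr_eq0; apply/eqP.
set X := N - N'.
suff X0 : mxnorm1 X <= 0.
  apply/matrixP => i j; rewrite [RHS]mxE; apply/eqP; rewrite eq_complex /=.
  have := le_trans (cnorm1_le_mxnorm1 X i j) X0; rewrite /cnorm1.
  have := normr_ge0 (complex.Re (X i j)); have := normr_ge0 (complex.Im (X i j)).
  move=> h1 h2 h3.
  by rewrite -!(normr_eq0 (_ (X i j))); apply/andP; split; apply/eqP; lra.
apply/ler_addgt0Pr => e e0; rewrite add0r.
have e20 : 0 < e / 2 by rewrite divr_gt0.
have [d d0 Hd] := gN _ e20; have [d' d'0 Hd'] := gN' _ e20.
(* A positive real parameter is enough: dividing the difference of the two expansions at [t] by [t]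
   isolates [N - N']. *)
pose t := Num.min d d' / 2.
have t0 : 0 < t by rewrite divr_gt0// lt_min d0 d'0.
have tE : cnorm1 (t%:C) = t by rewrite /cnorm1 /= normr0 addr0 gtr0_norm.
have tdd' : t < Num.min d d'.
  by rewrite /t ltr_pdivrMr// ltr_pMr ?ltr1n// lt_min d0 d'0.
move: tdd'; rewrite lt_min -{1 2}tE => /andP[/Hd + /Hd'].
rewrite tE; set U := g _ - A => h1 h2.
have -> : X = (t^-1)%:C *: ((U - t%:C *: N') - (U - t%:C *: N)).
  rewrite opprB addrC addrA subrK -scalerBr scalerA -rmorphM mulVf ?gt_eqF//.
  by rewrite rmorph1 scale1r.
apply: le_trans (mxnorm1Z _ _) _.
rewrite /cnorm1 /= normr0 addr0 gtr0_norm ?invr_gt0// ler_pdivrMl//.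
apply: le_trans (mxnorm1D _ _) _; rewrite mxnorm1N; lra.
Qed.

(** [V] is the coefficient matrix of one axis, of degree at most two in the parameter; [W] is its
    derivative at [l0] and [Z] its quadratic coefficient. The pair is [(a, 0)] in the [x]-direction
    and [(c0 a + u, a)] in the [t]-direction. *)
Variables (n : nat) (E V : R[i] -> R -> 'M[R[i]]_n) (l0 : R[i]).
Variables (W Z : R -> 'M[R[i]]_n).
Hypothesis E_deriv : forall l s, is_mxderive (E l) s (E l s *m V l s).
Hypothesis V_skew : forall s, (V l0 s)^t* = - V l0 s.
Hypothesis V_expand : forall eps s,
  V (l0 + eps) s - V l0 s = eps *: (W s + eps *: Z s).
Hypothesis E_unitary : forall s, (E l0 s)^t* *m E l0 s = 1%:M.
Hypothesis W_deriv : forall s, exists D, is_mxderive W s D.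
Hypothesis Z_deriv : forall s, exists D, is_mxderive Z s D.

Lemma frame_adj_deriv s :
  is_mxderive (fun y => (E l0 y)^t*) s (- (V l0 s *m (E l0 s)^t*)).
Proof.
have := is_mxderive_adj (E_deriv l0 s).
by rewrite trmx_mul map_mxM V_skew mulNmx.
Qed.

Lemma frame_conj_continuous (M : R -> 'M[R[i]]_n) :
  (forall s, exists D, is_mxderive M s D) ->
  forall i j,
  continuous (fun s => complex.Re ((E l0 s *m M s *m (E l0 s)^t*) i j)) /\
  continuous (fun s => complex.Im ((E l0 s *m M s *m (E l0 s)^t*) i j)).
Proof.
move=> MD i j; split=> s; have [D DM] := MD s;
  have [dR dI] := is_mxderiveM (is_mxderiveM (E_deriv l0 s) DM) (frame_adj_deriv s) i j.
  exact: (is_derive1_continuous dR).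
exact: (is_derive1_continuous dI).
Qed.

Let G eps s := E (l0 + eps) s *m (E l0 s)^t*.

(** Skewness gives the adjoint frame the coefficient [- V l0], so only [V (l0 + eps) - V l0]
    survives. Inserting [E0^* E0 = 1] puts [G] back in front of it. *)
Lemma frame_ratio_deriv eps s :
  is_mxderive (G eps) s (eps *: (G eps s *m
    (E l0 s *m W s *m (E l0 s)^t* + eps *: (E l0 s *m Z s *m (E l0 s)^t*)))).
Proof.
have := is_mxderiveM (E_deriv (l0 + eps) s) (frame_adj_deriv s).
rewrite (_ : _ + _ = E (l0 + eps) s *m (V (l0 + eps) s - V l0 s) *m (E l0 s)^t*).
  rewrite V_expand (_ : eps *: (G _ _ *m _) =
    E (l0 + eps) s *m (eps *: (W s + eps *: Z s)) *m (E l0 s)^t*) //.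
  rewrite /G -!mulmxA -scalemxAl -scalemxAr; congr (_ *: (_ *m _)).
  rewrite mulmxDr -scalemxAr !mulmxA E_unitary !mul1mx.
  by rewrite mulmxDl -scalemxAl.
by rewrite mulmxBr mulmxBl mulmxN !mulmxA.
Qed.

(** [P] is chosen before the endpoints, which allows [s1] to vary when the coefficient is
    differentiated. *)
Lemma frame_expands_interval a b :
  exists2 P : R -> 'M[R[i]]_n,
    forall s, a <= s <= b -> is_mxderive P s (E l0 s *m W s *m (E l0 s)^t*) &
    forall s0 s1 N, a <= s0 <= b -> a <= s1 <= b ->
      expands0 (G ^~ s0) 1%:M N -> expands0 (G ^~ s1) 1%:M (N + (P s1 - P s0)).
Proof.
have cW := frame_conj_continuous W_deriv; have cZ := frame_conj_continuous Z_deriv.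
have [P PD] := is_mxderive_primitive a b cW.
have [C1 WC] := continuous_bounded a b (mxnorm1_continuous cW).
have [C2 ZC] := continuous_bounded a b (mxnorm1_continuous cZ).
exists P => // s0 s1 N s0ab s1ab.
apply: (expands0_transport frame_ratio_deriv PD (C := Num.max C1 C2)) => // s sab.
  by rewrite le_max (le_trans (ler_norm _) (WC s sab)).
by rewrite le_max (le_trans (ler_norm _) (ZC s sab)) orbT.
Qed.

Lemma frame_expands s0 s1 N : expands0 (G ^~ s0) 1%:M N ->
  exists N', expands0 (G ^~ s1) 1%:M N'.
Proof.
move=> N0; have [P _ PG] := frame_expands_interval (Num.min s0 s1) (Num.max s0 s1).
exists (N + (P s1 - P s0)); apply: PG => //;
  by rewrite ge_min le_max lexx ?orbT.
Qed.

(** By uniqueness of the expansion coefficient, [N] and [P] differ by a constant near [s]; since [P]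
    depends on the interval, the comparison is local. *)
Lemma frame_expansion_deriv (N : R -> 'M[R[i]]_n) :
  (forall s, expands0 (G ^~ s) 1%:M (N s)) ->
  forall s, is_mxderive N s (E l0 s *m W s *m (E l0 s)^t*).
Proof.
move=> NG s; have [P PD PG] := frame_expands_interval (s - 1) (s + 1).
have ss : s - 1 <= s <= s + 1 by apply/andP; split; lra.
apply: (@is_mxderive_near _ _ (fun y => P y + (N s - P s))).
  near=> y.
  have yin : s - 1 <= y <= s + 1.
    have : `|s - y| < 1.
      by near: y; apply: (@nbhsx_ballx _ R^o); rewrite ltr01.
    by rewrite ltr_norml => /andP[? ?]; apply/andP; split; lra.
  apply: expands0_unique (NG y); rewrite addrCA.
  exact: PG.
rewrite -[X in is_mxderive _ _ X]addr0.
by apply: is_mxderiveD; [exact: PD|exact: is_mxderive_cst].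
Unshelve. all: by end_near. Qed.

End FrameParameter.

(** * Derivatives obtained from first-order expansions *)

(** The field is left general because both uses differ: [R[i]] for the derivative in the spectral
    parameter, [R] for derivatives along oblique lines. *)
Lemma derive1_of_expansion (K : numFieldType) (V : normedModType K)
    (f : K^o -> V) (x : K) (D : V) :
  (forall e : K, 0 < e -> exists2 d : K, 0 < d & forall h : K, `|h| < d ->
    `|f (h + x) - f x - h *: D| <= e * `|h|) ->
  derivable f x 1 /\ derive1 f x = D.
Proof.
move=> fD.
have cD : (fun h : K^o => h^-1 *: (f (h + x) - f x)) @ 0^' --> D.
  apply/cvgrPdist_le => /= e e0; have [d d0 Hd] := fD _ e0.
  near=> h.
  have h0 : h != 0 by near: h; exact: nbhs_dnbhs_neq.
  have hd : `|h| < d by near: h; exact: dnbhs0_lt.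
  have -> : D - h^-1 *: (f (h + x) - f x) =
      - (h^-1 *: (f (h + x) - f x - h *: D)).
    by rewrite [in RHS]scalerBr scalerA mulVf// scale1r opprB.
  by rewrite normrN normrZ normfV ler_pdivrMl ?normr_gt0// mulrC Hd.
have cD1 : (fun h : K^o => h^-1 *: ((f \o shift x) (h *: 1) - f x)) @ 0^' --> D.
  rewrite (_ : (fun h => _) = (fun h : K^o => h^-1 *: (f (h + x) - f x))) //.
  by apply/funext => h /=; rewrite [h *: 1]mulr1.
by split; [apply/cvg_ex; exists D|exact: cvg_lim].
Unshelve. all: by end_near. Qed.

Section ComplexDifferentiability.
Variable R : realType.

Lemma normc_i : `|'i%C : R[i]| = 1.
Proof. by rewrite normc_def /= expr0n add0r expr1n sqrtr1. Qed.

Lemma normc_le_cnorm1 (z : R[i]) : `|z| <= (cnorm1 z)%:C.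
Proof.
have nR (x : R) : `|x%:C| = `|x|%:C by rewrite normc_def /= expr0n addr0 sqrtr_sqr.
rewrite [in leLHS](_ : z = (complex.Re z)%:C + 'i%C * (complex.Im z)%:C).
  by apply: le_trans (ler_normD _ _) _; rewrite normrM normc_i mul1r !nR -rmorphD.
case: z => a b.
by apply/eqP; rewrite eq_complex /=; apply/andP; split; apply/eqP; ring.
Qed.

Lemma cnorm1_le_normc (z : R[i]) : (cnorm1 z)%:C <= 2 * `|z|.
Proof.
rewrite /cnorm1 rmorphD mulr_natl mulr2n; apply: lerD; first exact: normc_ge_Re.
have := normc_ge_Re ('i%C * z); rewrite normrM normc_i mul1r.
by case: z => a b /=; rewrite mul0r mul1r sub0r normrN.
Qed.

Lemma mx_norm_le_mxnorm1 m n (A : 'M[R[i]]_(m, n)) : mx_norm A <= (mxnorm1 A)%:C.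
Proof.
have [->|/mx_norm_neq0 [ij ->]] := eqVneq (mx_norm A) 0.
  by rewrite ler0c mxnorm1_ge0.
by apply: le_trans (normc_le_cnorm1 _) _; rewrite lecR cnorm1_le_mxnorm1.
Qed.

Lemma expands0_derive1 n (f : R[i] -> 'M[R[i]]_n) l0 (D : 'M[R[i]]_n) :
  expands0 (fun eps => f (l0 + eps)) (f l0) D ->
  derivable (f : R[i]^o -> 'M[R[i]]_n) l0 1 /\
  derive1 (f : R[i]^o -> 'M[R[i]]_n) l0 = D.
Proof.
move=> fD.
apply: derive1_of_expansion => e e0.
(* Positivity in the order on complex numbers forces [e] to be real. *)
have eE : e = (complex.Re e)%:C.
  by move: e0; rewrite ltcE /= => /andP[/eqP]; case: e => a b /= ->.
have e'0 : 0 < complex.Re e by rewrite -ltcR -eE.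
(* Tolerance and radius are both halved because [cnorm1 h] is bounded by [2 * |h|]. *)
have [d d0 Hd] := fD (complex.Re e / 2) (divr_gt0 e'0 (ltr0Sn _ 1)).
exists (2^-1 * d%:C); first by rewrite mulr_gt0 ?invr_gt0 ?ltr0n// ltcR.
move=> h; rewrite ltr_pdivlMl ?ltr0n// => hd.
have {hd} : cnorm1 h < d.
  by rewrite -ltcR; exact: le_lt_trans (cnorm1_le_normc h) hd.
move=> /Hd; rewrite (addrC l0) => Xe.
apply: le_trans (mx_norm_le_mxnorm1 _) _.
apply: (@le_trans _ _ (complex.Re e / 2 * cnorm1 h)%:C); first by rewrite lecR.
rewrite rmorphM /= [in leRHS]eE.
apply: le_trans (ler_wpM2l _ (cnorm1_le_normc h)) _.
  by rewrite ler0c ltW// divr_gt0.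
rewrite mulrA ler_wpM2r// -(rmorph_nat (real_complex R)) -rmorphM lecR /=.
by lra.
Qed.

End ComplexDifferentiability.

(** * Differentiation along oblique lines *)

Section ObliqueDerivative.
Variable R : realType.

Lemma is_derive_expansion (f : R -> R) x D :
  (forall e, 0 < e -> exists2 d, 0 < d & forall h, `|h| < d ->
    `|f (h + x) - f x - h * D| <= e * `|h|) -> is_derive x 1 f D.
Proof.
move=> fD; have [df eD] := @derive1_of_expansion R R^o f x D fD.
by apply: (DeriveDef df); rewrite -derive1E.
Qed.

Lemma is_derive_quadratic_remainder (f : R -> R) x (r C : R) : 0 < r -> 0 <= C ->
  f x = 0 -> (forall h, `|h| <= r -> `|f (h + x)| <= C * `|h| ^+ 2) ->
  is_derive x 1 f 0.
Proof.
move=> r0 C0 fx fC; apply: is_derive_expansion => e e0.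
have [d d0 Hd] := small_mul_le C0 e0.
exists (Num.min r d) => [|h]; first by rewrite lt_min r0.
rewrite lt_min => /andP[hr hd].
rewrite fx mulr0 !subr0; apply: le_trans (fC h (ltW hr)) _.
by rewrite expr2 mulrA ler_wpM2r// Hd.
Qed.

(** The factor [s - t] vanishes at [t], so continuity of [g] there is enough. *)
Lemma is_derive_mul_continuous (g : R -> R) t : {for t, continuous g} ->
  is_derive t 1 (fun s => (s - t) * g s) (g t).
Proof.
move=> cg; apply: is_derive_expansion => e e0.
have /cvgrPdist_le /(_ e e0) /nbhs_ballP [d /= d0 Hd] := cg.
exists d => // h hd.
rewrite subrr mul0r subr0 addrK -mulrBr normrM mulrC ler_wpM2r// distrC.
by apply: Hd; rewrite /ball /= opprD addrCA subrr addr0 normrN.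
Qed.

(* Derivative along an oblique line without a full differential: [f_x] is
   Lipschitz in [x] uniformly near the point, so replacing
   [f (X + c h, s) - f (X, s)] by [c h f_x (X, s)] costs only [O (h^2)]. *)
Lemma is_derive_oblique (f g k : R -> R -> R) (c M X t d r : R) :
  0 < r ->
  (forall x s : R, is_derive x 1 (f ^~ s) (g x s)) ->
  (forall x s : R, is_derive x 1 (g ^~ s) (k x s)) ->
  (forall x s : R, `|x - X| <= r -> `|s - t| <= r -> `|k x s| <= M) ->
  {for t, continuous (g X)} ->
  is_derive t 1 (f X) d ->
  is_derive t 1 (fun s => f (X + c * (s - t)) s) (d + c * g X t).
Proof.
move=> r0 fD gD kM cg fXD.
(* The linear term uses [g X s] rather than [g X t]: for each fixed [s] this is a Taylor remainder
   in [x] alone. *)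
pose rem s := f (X + c * (s - t)) s - f X s - c * ((s - t) * g X s).
have M0 : 0 <= M by apply: le_trans (kM X t _ _); rewrite ?subrr ?normr0 ?(ltW r0).
have remD : is_derive t 1 rem 0.
  have [d' d'0 Hd'] := small_mul_le (normr_ge0 c) r0.
  apply: (@is_derive_quadratic_remainder _ _ (Num.min r (d' / 2)) (M * c ^+ 2)).
  - by rewrite lt_min r0 divr_gt0.
  - by rewrite mulr_ge0// sqr_ge0.
  - by rewrite /rem subrr mulr0 mul0r mulr0 addr0 subrr subr0.
  move=> h; rewrite le_min => /andP[hr hd].
  have {hd}chr : `|c * h| <= r by rewrite normrM Hd'//; lra.
  rewrite /rem addrK; set s := h + t.
  have st : `|s - t| <= r by rewrite /s addrK.
  pose L := `|c * h|.
  have inL x : X - L <= x <= X + L -> `|x - X| <= L.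
    by move=> /andP[? ?]; rewrite ler_norml; apply/andP; split; lra.
  have L0 : 0 <= L by exact: normr_ge0.
  have g_lip x : X - L <= x <= X + L -> `|g x s - g X s| <= M * L.
    move=> xL.
    have kML z : X - L <= z <= X + L -> `|k z s| <= M.
      by move=> zL; apply: kM => //; exact: le_trans (inL z zL) chr.
    have XL : X - L <= X <= X + L by apply/andP; split; lra.
    apply: le_trans (mean_value_le (fun z _ => gD z s) kML xL XL) _.
    by rewrite ler_wpM2l// inL.
  have FD z : X - L <= z <= X + L ->
      is_derive z 1 (fun x => f x s - x * g X s) (g z s - g X s).
    move=> _; have -> : (fun x => f x s - x * g X s) =
        (f ^~ s) - (g X s \*: (id : R -> R)).
      by apply/funext => x; rewrite !fctE /= mulrC.
    apply: (is_derive_eq (is_deriveB (fD z s) (is_deriveZ _ (is_derive_id _ _)))).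
    by rewrite [_ *: 1]mulr1.
  have chL : X - L <= X + c * h <= X + L.
    have : `|c * h| <= L by []; rewrite ler_norml => /andP[? ?].
    by apply/andP; split; lra.
  have XL : X - L <= X <= X + L by apply/andP; split; lra.
  have := mean_value_le FD g_lip chL XL.
  have -> : X + c * h - X = c * h by ring.
  rewrite -/L (_ : M * L * L = M * c ^+ 2 * `|h| ^+ 2); last first.
    by rewrite -mulrA -expr2 /L normrM exprMn -[in RHS](real_normK (num_real c)); ring.
  by congr (`|_| <= _); ring.
have -> : (fun s => f (X + c * (s - t)) s) =
    f X + (c \*: (fun s => (s - t) * g X s)) + rem.
  by apply/funext => s; rewrite /rem !fctE -[X in _ = _ + X]addrA -opprD [RHS]addrC subrK.
have step := is_deriveD (is_deriveD fXD (is_deriveZ c (is_derive_mul_continuous cg))) remD.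
by apply: is_derive_eq step _; rewrite addr0.
Qed.

End ObliqueDerivative.

(** * Orthonormal frames and the adjoint representation *)

Section MovingFrames.
Variable R : realType.

Lemma ord3P (j : 'I_3) : [\/ j = i0, j = i1 | j = i2].
Proof.
by case: j => [[|[|[|]]]] // ?; [constructor 1|constructor 2|constructor 3];
  apply: val_inj.
Qed.

Lemma ordinal3_sum (V : nmodType) (F : 'I_3 -> V) :
  \sum_k F k = F i0 + F i1 + F i2.
Proof.
rewrite !big_ord_recl big_ord0 addr0 addrA.
by congr (F _ + F _ + F _); apply: val_inj.
Qed.

Lemma su2_coordD (X Y : 'M[R[i]]_2) : su2_coord (X + Y) = su2_coord X + su2_coord Y.
Proof.
by apply/colP => i; case: (ord3P i) => ->; rewrite !mxE /= ?raddfD.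
Qed.

Lemma su2_coordZ (x : R) (X : 'M[R[i]]_2) :
  su2_coord (x%:C *: X) = x *: su2_coord X.
Proof.
apply/colP => i; rewrite /su2_coord !mxE; case: (ord3P i) => -> /=.
- by case: (X 0 0) => ? ? /=; ring.
- by case: (X 0 1) => ? ? /=; ring.
- by case: (X 0 1) => ? ? /=; ring.
Qed.

Lemma su2_coord_comb (c : 'I_3 -> R) (X : 'I_3 -> 'M[R[i]]_2) i :
  su2_coord (\sum_k (c k)%:C *: X k) i 0 = \sum_k c k * su2_coord (X k) i 0.
Proof.
have mxD (x y : 'cV[R]_3) : (x + y) i 0 = x i 0 + y i 0 by rewrite mxE.
have mxZ a (x : 'cV[R]_3) : (a *: x) i 0 = a * x i 0 by rewrite mxE.
by rewrite !ordinal3_sum !su2_coordD !su2_coordZ; rewrite !mxD !mxZ.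
Qed.

Lemma su2_coord_derive (F : R -> 'M[R[i]]_2) s D i : is_mxderive F s D ->
  is_derive s 1 (fun y => su2_coord (F y) i 0) (su2_coord D i 0).
Proof.
move=> FD; rewrite !mxE; case: (ord3P i) => -> /=.
- rewrite (_ : (fun y => _) = (fun y => complex.Im (F y 0 0))).
    by case: (FD 0 0).
  by apply/funext => y; rewrite !mxE.
- rewrite (_ : (fun y => _) = (fun y => complex.Re (F y 0 1))).
    by case: (FD 0 1).
  by apply/funext => y; rewrite !mxE.
- rewrite (_ : (fun y => _) = (fun y => complex.Im (F y 0 1))).
    by case: (FD 0 1).
  by apply/funext => y; rewrite !mxE.
Qed.

Lemma su2_mxD (v w : 'cV[R]_3) : su2_mx (v + w) = su2_mx v + su2_mx w.
Proof. by rewrite /su2_mx !mxE !rmorphD !scalerDl [X in X + _ = _]addrACA [LHS]addrACA. Qed.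

Lemma su2_mxZ (x : R) (v : 'cV[R]_3) : su2_mx (x *: v) = x%:C *: su2_mx v.
Proof. by rewrite /su2_mx !mxE !rmorphM -!scalerA -!scalerDr. Qed.

Lemma su2_mx_bracket (v w : 'cV[R]_3) :
  su2_mx v *m su2_mx w - su2_mx w *m su2_mx v = su2_mx (2 *: cross v w).
Proof.
by rewrite su2_mxZ cross_su2 rmorph_nat scalerA divff ?scale1r.
Qed.

Definition delta_coord (j : 'I_3) : 'cV[R]_3 :=
  nth 0 [:: vec3 1 0 0; vec3 0 0 (- 1); vec3 0 1 0] j.

Lemma deltaE j : delta R j = su2_mx (delta_coord j).
Proof.
by case: (ord3P j) => ->; rewrite /su2_mx !mxE /= ?rmorphN ?rmorph0 ?rmorph1
  ?scaleN1r ?scale0r ?scale1r ?addr0 ?add0r.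
Qed.

Lemma delta_su2 j : su2 (delta R j).
Proof. by rewrite deltaE; exact: su2_mx_su2. Qed.

Lemma su2_conj (U X : 'M[R[i]]_2) : U^t* *m U = 1%:M -> su2 X ->
  su2 (U *m X *m U^t*).
Proof.
move=> UU [Xs Xt]; split.
  by rewrite !trmx_mul !map_mxM -/(U^t*) trmxCK Xs mulNmx mulmxN mulmxA.
by rewrite mxtrace_mulC mulmxA UU mul1mx.
Qed.

Lemma unitary_invmx (U : 'M[R[i]]_2) : U^t* *m U = 1%:M -> invmx U = U^t*.
Proof.
move=> UU; have /mulmx1C UU' := UU.
by rewrite -[RHS]mulmx1 -(mulmxV (mulmx1_unit UU').1) mulmxA UU mul1mx.
Qed.

(** This is the adjoint action of su(2) in the basis [delta]. The factor 2 comes from [[X, Y] = 2 X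
    x Y]; it turns [c0 / 2] into the entry [c0], and [q] at time 0 into [2 q = r1 + i r2]. *)
Lemma su2_bracket_delta (v : 'cV[R]_3) j :
  su2_mx v *m delta R j - delta R j *m su2_mx v =
  \sum_k (h_connection (2 * v i0 0) (2 * v i1 0) (2 * v i2 0) k j)%:C *: delta R k.
Proof.
rewrite ordinal3_sum !deltaE su2_mx_bracket -!su2_mxZ -!su2_mxD; congr su2_mx.
apply/colP => i; case: (ord3P i) => ->; case: (ord3P j) => ->;
  by rewrite !mxE /=; ring.
Qed.

Lemma Ad_deltaE (U : 'M[R[i]]_2) i j : U^t* *m U = 1%:M ->
  Ad_delta U i j = su2_coord (U *m delta R j *m U^t*) i 0.
Proof. by move=> UU; rewrite mxE unitary_invmx. Qed.

Lemma su2_mx_Ad_delta (U : 'M[R[i]]_2) j : U^t* *m U = 1%:M ->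
  su2_mx (col j (Ad_delta U)) = U *m delta R j *m U^t*.
Proof.
move=> UU; rewrite -[RHS]su2_coordK; last exact: su2_conj UU (delta_su2 j).
by congr su2_mx; apply/colP => i; rewrite mxE Ad_deltaE.
Qed.

(** Conjugation respects products, hence commutators and cross products, so the multiplication table
    of the columns is that of [delta]. *)
Lemma Ad_delta_cross (U : 'M[R[i]]_2) j k : U^t* *m U = 1%:M ->
  su2_mx (cross (col j (Ad_delta U)) (col k (Ad_delta U))) =
  U *m su2_mx (cross (delta_coord j) (delta_coord k)) *m U^t*.
Proof.
move=> UU.
have UM X Y : U *m X *m U^t* *m (U *m Y *m U^t*) = U *m (X *m Y) *m U^t*.
  by rewrite !mulmxA -(mulmxA _ (U^t*)) UU mulmx1.
rewrite !cross_su2 !su2_mx_Ad_delta// !UM -mulmxBl -mulmxBr !deltaE.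
by rewrite -scalemxAr -scalemxAl.
Qed.

Lemma Ad_delta_cross01 (U : 'M[R[i]]_2) : U^t* *m U = 1%:M ->
  cross (col i0 (Ad_delta U)) (col i1 (Ad_delta U)) = col i2 (Ad_delta U).
Proof.
move=> UU; apply: (can_inj (@su2_mxK R)).
have cross01 : cross (delta_coord i0) (delta_coord i1) = delta_coord i2.
  by apply/colP => i; case: (ord3P i) => ->; rewrite !mxE /=; ring.
by rewrite (Ad_delta_cross _ _ UU) (su2_mx_Ad_delta _ UU) deltaE cross01.
Qed.

Lemma Ad_delta_cross02 (U : 'M[R[i]]_2) : U^t* *m U = 1%:M ->
  cross (col i0 (Ad_delta U)) (col i2 (Ad_delta U)) = - col i1 (Ad_delta U).
Proof.
move=> UU; apply: (can_inj (@su2_mxK R)).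
have cross02 : cross (delta_coord i0) (delta_coord i2) = -1 *: delta_coord i1.
  by apply/colP => i; case: (ord3P i) => ->; rewrite !mxE /=; ring.
rewrite (Ad_delta_cross _ _ UU) -[- col _ _]scaleN1r cross02 !su2_mxZ.
by rewrite (su2_mx_Ad_delta _ UU) deltaE -scalemxAr -scalemxAl.
Qed.

Lemma cross_linear_r (u v w : 'cV[R]_3) x y :
  cross u (x *: v + y *: w) = x *: cross u v + y *: cross u w.
Proof.
by apply/colP => i; case: (ord3P i) => ->; rewrite !mxE /=; ring.
Qed.

(** * Derivatives of real matrix functions and of moving frames *)

Definition is_rderive m n (F : R -> 'M[R]_(m, n)) (s : R)
    (D : 'M[R]_(m, n)) : Prop :=
  forall i j, is_derive s 1 (fun y => F y i j) (D i j).

(** As [v] gives a skew-hermitian matrix, differentiating [U delta_j U^*] produces [U [v, delta_j]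
    U^*], and [su2_bracket_delta] expands the bracket in the columns. *)
Lemma Ad_delta_derive (U : R -> 'M[R[i]]_2) (v : 'cV[R]_3) s :
  (forall y, (U y)^t* *m U y = 1%:M) ->
  is_mxderive U s (U s *m su2_mx v) ->
  is_rderive (fun y => Ad_delta (U y)) s
    (Ad_delta (U s) *m h_connection (2 * v i0 0) (2 * v i1 0) (2 * v i2 0)).
Proof.
move=> UU UD i j.
have -> : (fun y => Ad_delta (U y) i j) =
    (fun y => su2_coord (U y *m delta R j *m (U y)^t*) i 0).
  by apply/funext => y; rewrite Ad_deltaE.
have [vs _] := su2_mx_su2 v.
have := is_mxderiveM (is_mxderiveMr (delta R j) UD) (is_mxderive_adj UD).
rewrite trmx_mul map_mxM vs mulNmx mulmxN !mulmxA -mulmxBl -!mulmxA -mulmxBr.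
rewrite su2_bracket_delta => /(su2_coord_derive i) /is_derive_eq; apply.
rewrite mulmx_sumr mulmx_suml [RHS]mxE.
under eq_bigr do rewrite -scalemxAr -scalemxAl.
rewrite su2_coord_comb; apply: eq_bigr => k _.
by rewrite mulrC (Ad_deltaE _ _ (UU s)).
Qed.

Lemma is_rderive_unfold m n (F : R -> 'M[R]_(m.+1, n.+1)) (s : R) D :
  is_rderive F s D -> derivable F s 1 /\ derive1 F s = D.
Proof.
move=> FD.
have dF : derivable F s 1 by apply/derivable_mxP => i j; case: (FD i j).
split=> //; rewrite derive1E derive_mx//; apply/matrixP => i j; rewrite mxE.
exact: (@derive_val _ _ _ _ _ _ _ (FD i j)).
Qed.

Lemma derivable_is_rderive m n (F : R -> 'M[R]_(m.+1, n.+1)) (s : R) :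
  derivable F s 1 -> is_rderive F s (derive1 F s).
Proof.
move=> dF i j; have /derivable_mxP/(_ i j) dFij := dF.
by apply: (DeriveDef dFij); rewrite derive1E derive_mx// mxE.
Qed.

Lemma is_rderiveB m n (F G : R -> 'M[R]_(m, n)) (s : R) dF dG :
  is_rderive F s dF -> is_rderive G s dG ->
  is_rderive (fun y => F y - G y) s (dF - dG).
Proof.
move=> FD GD i j; rewrite !mxE (_ : (fun y => _) =
  (fun y => F y i j) - (fun y => G y i j)); last first.
  by apply/funext => y; rewrite !mxE.
exact: is_deriveB.
Qed.

Lemma is_rderiveM m n p (F : R -> 'M[R]_(m, n)) (G : R -> 'M[R]_(n, p)) (s : R)
    dF dG : is_rderive F s dF -> is_rderive G s dG ->
  is_rderive (fun y => F y *m G y) s (dF *m G s + F s *m dG).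
Proof.
move=> FD GD i j.
have -> : (fun y => (F y *m G y) i j) =
    \sum_k ((fun y => F y i k) * (fun y => G y k j)).
  by apply/funext => y; rewrite fct_sumE mxE.
apply: is_derive_eq (is_derive_sum (fun k => is_deriveM (FD i k) (GD k j))) _.
rewrite big_split addrC !mxE; congr (_ + _).
by apply: eq_bigr => k _; rewrite [_ *: _]mulrC.
Qed.

Lemma is_rderive_trmx m n (F : R -> 'M[R]_(m, n)) (s : R) dF :
  is_rderive F s dF -> is_rderive (fun y => (F y)^T) s dF^T.
Proof.
move=> FD i j; rewrite mxE (_ : (fun y => _) = fun y => F y j i) //.
by apply/funext => y; rewrite mxE.
Qed.

Lemma is_rderive_shift m n (F : R -> 'M[R]_(m, n)) (c s : R) D :
  is_rderive F (s + c) D -> is_rderive (fun y => F (y + c)) s D.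
Proof.
move=> FD i j; have cD := is_deriveD (is_derive_id s 1) (is_derive_cst c s 1).
have := @is_derive1_comp R (fun y => F y i j) (fun y => y + c) s _ _ (FD i j) cD.
by rewrite addr0 mulr1.
Qed.

Lemma is_rderive_0_cst m n (F : R -> 'M[R]_(m, n)) :
  (forall s, is_rderive F s 0) -> forall s s', F s = F s'.
Proof.
move=> F0 s s'; apply/matrixP => i j.
apply: (@is_derive_0_is_cst _ (fun s => F s i j)) => y.
by have := F0 y i j; rewrite mxE.
Qed.

(* [F G^T] is conserved because the connection matrix is
   antisymmetric. *)
Lemma skew_frames_cst n (F G Om : R -> 'M[R]_n) :
  (forall s, (Om s)^T = - Om s) ->
  (forall s, is_rderive F s (F s *m Om s)) ->
  (forall s, is_rderive G s (G s *m Om s)) ->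
  forall s s', F s *m (G s)^T = F s' *m (G s')^T.
Proof.
move=> OmT FD GD; apply: is_rderive_0_cst => s.
have := is_rderiveM (FD s) (is_rderive_trmx (GD s)).
by rewrite trmx_mul OmT mulNmx mulmxN mulmxA subrr.
Qed.

Lemma h_connection_skew (c0 r1 r2 : R) :
  (h_connection c0 r1 r2)^T = - h_connection c0 r1 r2.
Proof.
apply/matrixP => i j; case: (ord3P i) => ->; case: (ord3P j) => ->;
  by rewrite !mxE /= ?opprK ?oppr0.
Qed.

End MovingFrames.

(** * The frame of a solution of the NLS *)

Section NLSFrame.
Variables (R : realType) (c0 : R) (q : R -> R -> R[i]).
Variables (phi0 : 'M[R[i]]_2) (E : R -> R -> R[i] -> 'M[R[i]]_2).
Hypothesis q_smooth : csmooth2 q.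
Hypothesis E_frame : NLS_frame q E.
Hypothesis E_init : forall lam, E 0 0 lam = phi0.

Let l0 : R[i] := (c0 / 2)%:C.
Let U x t := E x t l0.
Let H x t := Ad_delta (U x t).
Let N x t := eta E l0 x t.
Let qR x t : R := complex.Re (q x t).
Let qI x t : R := complex.Im (q x t).

Let Vx l x t : 'M[R[i]]_2 := l *: mxa R + mxu q x t.
Let Vt l x t : 'M[R[i]]_2 := l ^+ 2 *: mxa R + l *: mxu q x t + mxQ q x t.
(** At the real value [l0] both coefficient matrices lie in su(2). Their coordinates yield skewness
    and the connection of the real frame. *)
Let vx x t : 'cV[R]_3 := vec3 (c0 / 2) (qR x t) (qI x t).
Let vt x t : 'cV[R]_3 :=
  vec3 ((c0 / 2) ^+ 2 - (qR x t ^+ 2 + qI x t ^+ 2) / 2)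
       (c0 / 2 * qR x t - complex.Im (cdx q x t) / 2)
       (c0 / 2 * qI x t + complex.Re (cdx q x t) / 2).

Lemma NLS_frame_x l x t : is_mxderive (fun y => E y t l) x (E x t l *m Vx l x t).
Proof.
have [Eu /mxcderivableP Ex _ [eqx _ _]] := E_frame x t l.
by rewrite /Vx -eqx mulmxA mulmxV// mul1mx.
Qed.

Lemma NLS_frame_t l x t : is_mxderive (fun s => E x s l) t (E x t l *m Vt l x t).
Proof.
have [Eu _ /mxcderivableP Et [_ eqt _]] := E_frame x t l.
by rewrite /Vt -eqt mulmxA mulmxV// mul1mx.
Qed.

Lemma NLS_frame_unitary x t : (U x t)^t* *m U x t = 1%:M.
Proof.
have [_ _ _ [_ _]] := E_frame x t l0.
by rewrite (_ : l0^*%C = l0)// /l0 /= oppr0.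
Qed.

Lemma mxa_delta : mxa R = su2_mx (vec3 1 0 0).
Proof. by rewrite -(deltaE R i0). Qed.

Lemma mxu_su2 x t : mxu q x t = su2_mx (vec3 0 (qR x t) (qI x t)).
Proof.
rewrite su2_mxE /qR /qI; apply: mx2P; rewrite !mxE /= oppr0.
by case: (q x t) => a b /=; split => //; apply/eqP; rewrite eq_complex /= opprK !eqxx.
Qed.

Lemma mxQ_su2 x t : mxQ q x t =
  su2_mx (vec3 (- (qR x t ^+ 2 + qI x t ^+ 2) / 2)
    (- complex.Im (cdx q x t) / 2) (complex.Re (cdx q x t) / 2)).
Proof.
have half : 'i%C / 2 = (0 +i* 2^-1)%C :> R[i].
  have -> : 2^-1 = (2^-1)%:C :> R[i] by rewrite fmorphV rmorph_nat.
  by apply/eqP; rewrite eq_complex /=; apply/andP; split; apply/eqP; ring.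
rewrite /mxQ half sqr_normc su2_mxE /qR /qI; move: (cdx q x t) => [c d].
case: (q x t) => a b /=; apply: mx2P; rewrite !mxE /=.
by split; apply/eqP; rewrite eq_complex /=; apply/andP; split; apply/eqP; ring.
Qed.

Lemma Vx_su2 x t : Vx l0 x t = su2_mx (vx x t).
Proof.
rewrite /Vx mxa_delta mxu_su2 /l0 -su2_mxZ -su2_mxD; congr su2_mx.
by apply/colP => i; case: (ord3P i) => ->; rewrite !mxE /=; ring.
Qed.

Lemma Vt_su2 x t : Vt l0 x t = su2_mx (vt x t).
Proof.
rewrite /Vt mxa_delta mxu_su2 mxQ_su2 /l0 -rmorphXn -!su2_mxZ -!su2_mxD; congr su2_mx.
by apply/colP => i; case: (ord3P i) => ->; rewrite !mxE /=; ring.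
Qed.

Lemma q_deriv_t x t : exists D, is_cderive (fun s => q x s) t D.
Proof.
have [/(_ 1%N) [_ [_ dR _ _]] /(_ 1%N) [_ [_ dI _ _]]] := q_smooth.
exists (cdt q x t); split.
  by apply: (DeriveDef (dR x t)); rewrite -derive1E.
by apply: (DeriveDef (dI x t)); rewrite -derive1E.
Qed.

Lemma mxu_deriv (f : R -> R[i]) (s : R) d : is_cderive f s d ->
  exists D, is_mxderive
    (fun y => mx_of_rows 2 2 [:: [:: 0; f y]; [:: - (f y)^*%C; 0]]) s D.
Proof.
move=> fD; have fJ := is_cderiveM (is_cderive_cst (-1) s) (is_cderive_conj fD).
have fJ' : exists d', is_cderive (fun y => - (f y)^*%C) s d'.
  exists (0 * (f s)^*%C + -1 * d^*%C).
  by rewrite (_ : (fun y => _) = fun y => -1 * (f y)^*%C)//; apply/funext => y; rewrite mulN1r.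
have {fJ fJ'} [d' fJ] := fJ'.
exists (mx_of_rows 2 2 [:: [:: 0; d]; [:: d'; 0]]) => i j.
case: (unliftP ord0 i) => [i'|] ->; case: (unliftP ord0 j) => [j'|] ->;
  rewrite ?(ord1 i') ?(ord1 j') mxE /=.
- rewrite (_ : (fun y => _) = fun=> 0); first exact: is_cderive_cst.
  by apply/funext => y; rewrite mxE.
- rewrite (_ : (fun y => _) = fun y => - (f y)^*%C) //.
  by apply/funext => y; rewrite mxE.
- by rewrite (_ : (fun y => _) = f) //; apply/funext => y; rewrite mxE.
- rewrite (_ : (fun y => _) = fun=> 0); first exact: is_cderive_cst.
  by apply/funext => y; rewrite mxE.
Qed.

Lemma mxu_deriv_t x t : exists D, is_mxderive (fun s => mxu q x s) t D.
Proof. by have [d] := q_deriv_t x t; exact: mxu_deriv. Qed.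

Lemma Vx_skew x t : (Vx l0 x t)^t* = - Vx l0 x t.
Proof. by rewrite Vx_su2; have [] := su2_mx_su2 (vx x t). Qed.

Lemma Vt_skew x t : (Vt l0 x t)^t* = - Vt l0 x t.
Proof. by rewrite Vt_su2; have [] := su2_mx_su2 (vt x t). Qed.

Lemma Vx_expand eps x t : Vx (l0 + eps) x t - Vx l0 x t = eps *: (mxa R + eps *: 0).
Proof. by rewrite /Vx opprD addrACA subrr addr0 -scalerBl addrAC subrr add0r scaler0 addr0. Qed.

(** The first-order coefficient of [lam^2 a + lam u] at [l0] is [2 l0 a + u], and [2 l0 = c0]. *)
Lemma Vt_expand eps x t : Vt (l0 + eps) x t - Vt l0 x t =
  eps *: ((c0%:C *: mxa R + mxu q x t) + eps *: mxa R).
Proof.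
have -> : c0%:C = l0 + l0 by rewrite /l0 -rmorphD /=; congr (_%:C); field.
by apply/matrixP => i j; rewrite /Vt !mxE; ring.
Qed.

Let G x t eps := E x t (l0 + eps) *m (U x t)^t*.

(** At the origin [G] is identically 1 and expands with coefficient 0. The expansion is carried to
    [(x, 0)] by the [x]-equation and on to [(x, t)] by the [t]-equation. *)
Lemma NLS_frame_expands x t : exists D, expands0 (G x t) 1%:M D.
Proof.
have step_x D0 : expands0 (G 0 0) 1%:M D0 -> exists D, expands0 (G x 0) 1%:M D.
  apply: (@frame_expands _ _ (fun l y => E y 0 l) (fun l y => Vx l y 0) l0
    (fun=> mxa R) (fun=> 0)) => [l s|s|eps s|s|s|s].
  - exact: NLS_frame_x.
  - exact: Vx_skew.
  - exact: Vx_expand.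
  - exact: NLS_frame_unitary.
  - by exists 0; exact: is_mxderive_cst.
  - by exists 0; exact: is_mxderive_cst.
have step_t D0 : expands0 (G x 0) 1%:M D0 -> exists D, expands0 (G x t) 1%:M D.
  apply: (@frame_expands _ _ (fun l s => E x s l) (fun l s => Vt l x s) l0
    (fun s => c0%:C *: mxa R + mxu q x s) (fun=> mxa R)) => [l s|s|eps s|s|s|s].
  - exact: NLS_frame_t.
  - exact: Vt_skew.
  - exact: Vt_expand.
  - exact: NLS_frame_unitary.
  - have [D uD] := mxu_deriv_t x s.
    by exists (0 + D); apply: is_mxderiveD => //; exact: is_mxderive_cst.
  - by exists 0; exact: is_mxderive_cst.
have [|D /step_t//] := step_x 0.
move=> e e0; exists 1 => // eps _.
rewrite /G /U !E_init scaler0 subr0 -(E_init l0) (mulmx1C (NLS_frame_unitary 0 0)).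
rewrite subrr; have := mxnorm1Z 0 (0 : 'M[R[i]]_2).
rewrite scale0r {1}/cnorm1 /= normr0 addr0 mul0r => /le_trans; apply.
by rewrite mulr_ge0 ?cnorm1_ge0 ?ltW.
Qed.

(** Multiplying the expansion of the ratio by [U] on the right shows that [E] has [lam]-derivative
    [D U]; [eta] cancels [U] and returns the coefficient [D]. *)
Lemma NLS_frame_derivable x t :
  derivable (E x t : R[i]^o -> 'M[R[i]]_2) l0 1 /\ expands0 (G x t) 1%:M (N x t).
Proof.
have [D GD] := NLS_frame_expands x t.
have UU := mulmx1C (NLS_frame_unitary x t).
have [|dE eE] := @expands0_derive1 R 2 (E x t) l0 (D *m U x t).
  move=> e e0; have K0 : 0 < mxnorm1 (U x t) + 1.
    by rewrite ltr_wpDl// mxnorm1_ge0.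
  have [d d0 Hd] := GD _ (divr_gt0 e0 K0); exists d => // eps /Hd He.
  have -> : E x t (l0 + eps) - E x t l0 - eps *: (D *m U x t) =
      (G x t eps - 1%:M - eps *: D) *m U x t.
    by rewrite !mulmxBl mul1mx -scalemxAl /G -mulmxA NLS_frame_unitary mulmx1.
  apply: le_trans (mxnorm1M _ _) _.
  apply: le_trans (ler_wpM2r (mxnorm1_ge0 _) He) _.
  rewrite mulrAC ler_wpM2r ?cnorm1_ge0// -mulrA ler_piMr ?ltW// mulrC.
  by rewrite ltr_pdivrMr// mul1r ltrDl.
split => //; suff -> : N x t = D by [].
by rewrite /N /eta eE unitary_invmx ?NLS_frame_unitary// -mulmxA UU mulmx1.
Qed.

Lemma eta_deriv_x x t :
  is_mxderive (fun y => N y t) x (U x t *m mxa R *m (U x t)^t*).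
Proof.
apply: (@frame_expansion_deriv _ _ (fun l y => E y t l) (fun l y => Vx l y t) l0
    (fun=> mxa R) (fun=> 0) _ _ _ _ _ _ (fun y => N y t)) => [l s|s|eps s|s|s|s|s].
- exact: NLS_frame_x.
- exact: Vx_skew.
- exact: Vx_expand.
- exact: NLS_frame_unitary.
- by exists 0; exact: is_mxderive_cst.
- by exists 0; exact: is_mxderive_cst.
- by case: (NLS_frame_derivable s t).
Qed.

Lemma eta_deriv_t x t : is_mxderive (fun s => N x s) t
  (U x t *m (c0%:C *: mxa R + mxu q x t) *m (U x t)^t*).
Proof.
apply: (@frame_expansion_deriv _ _ (fun l s => E x s l) (fun l s => Vt l x s) l0
    (fun s => c0%:C *: mxa R + mxu q x s) (fun=> mxa R) _ _ _ _ _ _ (fun s => N x s))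
    => [l s|s|eps s|s|s|s|s].
- exact: NLS_frame_t.
- exact: Vt_skew.
- exact: Vt_expand.
- exact: NLS_frame_unitary.
- have [D uD] := mxu_deriv_t x s.
  by exists (0 + D); apply: is_mxderiveD => //; exact: is_mxderive_cst.
- by exists 0; exact: is_mxderive_cst.
- by case: (NLS_frame_derivable x s).
Qed.

Lemma eta_origin : N 0 0 = 0.
Proof.
rewrite /N /eta (_ : E 0 0 = cst phi0); last by apply/funext => l; rewrite E_init.
by rewrite derive1_cst mul0mx.
Qed.

(** Both partial derivatives are conjugates of elements of su(2), so [N^* + N] and the trace of [N]
    are constant along the axes; they vanish at the origin. *)
Lemma eta_su2 x t : su2 (N x t).
Proof.
have a_su2 : su2 (mxa R) by rewrite mxa_delta; exact: su2_mx_su2.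
have W_su2 y s : su2 (c0%:C *: mxa R + mxu q y s).
  by rewrite mxa_delta mxu_su2 -su2_mxZ -su2_mxD; exact: su2_mx_su2.
have dx_su2 y s := su2_conj (NLS_frame_unitary y s) a_su2.
have dt_su2 y s := su2_conj (NLS_frame_unitary y s) (W_su2 y s).
split.
  apply/eqP; rewrite -addr_eq0; apply/eqP.
  rewrite (@is_mxderive_0_cst _ _ _ (fun s => (N x s)^t* + N x s) _ t 0); last first.
    move=> s; have := is_mxderiveD (is_mxderive_adj (eta_deriv_t x s)) (eta_deriv_t x s).
    by have [-> _] := dt_su2 x s; rewrite addNr.
  rewrite (@is_mxderive_0_cst _ _ _ (fun y => (N y 0)^t* + N y 0) _ x 0); last first.
    move=> y; have := is_mxderiveD (is_mxderive_adj (eta_deriv_x y 0)) (eta_deriv_x y 0).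
    by have [-> _] := dx_su2 y 0; rewrite addNr.
  by rewrite eta_origin trmx0 map_mx0 addr0.
rewrite (@is_cderive_0_cst _ (fun s => \tr (N x s)) _ t 0); last first.
  by move=> s; have := is_mxderive_tr (eta_deriv_t x s); have [_ ->] := dt_su2 x s.
rewrite (@is_cderive_0_cst _ (fun y => \tr (N y 0)) _ x 0); last first.
  by move=> y; have := is_mxderive_tr (eta_deriv_x y 0); have [_ ->] := dx_su2 y 0.
by rewrite eta_origin mxtrace0.
Qed.

Lemma Ad_frame_x x t : is_rderive (fun y => H y t) x
  (H x t *m h_connection c0 (2 * qR x t) (2 * qI x t)).
Proof.
have -> : c0 = 2 * vx x t i0 0 by rewrite mxE /=; field.
have -> : qR x t = vx x t i1 0 by rewrite mxE.
have -> : qI x t = vx x t i2 0 by rewrite mxE.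
apply: (@Ad_delta_derive R (U ^~ t) (vx x t) x (NLS_frame_unitary ^~ t)).
by rewrite -Vx_su2; exact: NLS_frame_x.
Qed.

Lemma Ad_frame_t x t : is_rderive (fun s => H x s) t (H x t *m
  h_connection (2 * vt x t i0 0) (2 * vt x t i1 0) (2 * vt x t i2 0)).
Proof.
apply: (@Ad_delta_derive R (U x) (vt x t) t (NLS_frame_unitary x)).
by rewrite -Vt_su2; exact: NLS_frame_t.
Qed.

Lemma eta_coord_x x t :
  is_rderive (fun y => su2_coord (N y t)) x (col i0 (H x t)).
Proof.
move=> i j; rewrite (ord1 j) [col _ _ _ _]mxE Ad_deltaE ?NLS_frame_unitary//.
exact: su2_coord_derive (eta_deriv_x x t).
Qed.

Lemma eta_coord_t x t : is_rderive (fun s => su2_coord (N x s)) t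
  (c0 *: col i0 (H x t) + (qR x t *: col i2 (H x t) - qI x t *: col i1 (H x t))).
Proof.
move=> i j; rewrite (ord1 j).
have := su2_coord_derive i (eta_deriv_t x t); set D := su2_coord _ => ND.
suff <- : D = c0 *: col i0 (H x t) +
    (qR x t *: col i2 (H x t) - qI x t *: col i1 (H x t)) by [].
rewrite /D; apply: (can_inj (@su2_mxK R)).
rewrite su2_coordK; last first.
  apply: su2_conj (NLS_frame_unitary x t) _.
  by rewrite mxa_delta mxu_su2 -su2_mxZ -su2_mxD; exact: su2_mx_su2.
rewrite -scaleNr !su2_mxD !su2_mxZ !(su2_mx_Ad_delta _ (NLS_frame_unitary x t)).
have -> : c0%:C *: mxa R + mxu q x t = c0%:C *: delta R i0 +
    ((qR x t)%:C *: delta R i2 + (- qI x t)%:C *: delta R i1).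
  rewrite mxa_delta mxu_su2 !deltaE -!su2_mxZ -!su2_mxD; congr su2_mx.
  by apply/colP => k; case: (ord3P k) => ->; rewrite !mxE /=; ring.
by rewrite !mulmxDr !mulmxDl -!scalemxAr -!scalemxAl.
Qed.

(** * Bounds on the real frame, and the translated curve *)

Hypothesis H0_orthogonal : H 0 0 *m (H 0 0)^T = 1%:M.

Lemma Ad_frame_orthogonal x t : H x t *m (H x t)^T = 1%:M.
Proof.
rewrite (@skew_frames_cst R 3 (H x) (H x) (fun s =>
  h_connection (2 * vt x s i0 0) (2 * vt x s i1 0) (2 * vt x s i2 0)) _ _ _ t 0).
- rewrite (@skew_frames_cst R 3 (H ^~ 0) (H ^~ 0) (fun y =>
    h_connection c0 (2 * qR y 0) (2 * qI y 0)) _ _ _ x 0) => [//|s|s|s].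
  + exact: h_connection_skew.
  + exact: Ad_frame_x.
  + exact: Ad_frame_x.
- by move=> s; exact: h_connection_skew.
- by move=> s; exact: Ad_frame_t.
- by move=> s; exact: Ad_frame_t.
Qed.

(** Rows of an orthogonal matrix have unit length. With the local bound on [q] this controls
    [eta_xx], as [is_derive_oblique] requires. *)
Lemma Ad_frame_le1 x t i j : `|H x t i j| <= 1.
Proof.
have := congr1 (fun A : 'M[R]_3 => A i i) (Ad_frame_orthogonal x t).
have trE k : (H x t)^T k i = H x t i k by rewrite [LHS]mxE.
rewrite [LHS]mxE [RHS]mxE eqxx (bigD1 j)//= trE -expr2 => sum1.
rewrite -(expr_le1 (n := 2)) ?normr_ge0// real_normK ?num_real// -[leRHS]sum1 lerDl.
by apply: sumr_ge0 => k _; rewrite trE -expr2 sqr_ge0.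
Qed.

Lemma q_locally_bounded X t : exists2 r : R, 0 < r & exists M : R,
  forall x s, `|x - X| <= r -> `|s - t| <= r -> `|qR x s| <= M /\ `|qI x s| <= M.
Proof.
have [/(_ 0%N) [cR _] /(_ 0%N) [cI _]] := q_smooth.
have /cvgrPdist_le /(_ 1 ltr01) /nbhs_ballP [d /= d0 Hd] := cR (X, t).
have /cvgrPdist_le /(_ 1 ltr01) /nbhs_ballP [d' /= d'0 Hd'] := cI (X, t).
pose m := Num.min d d'; have m0 : 0 < m by rewrite lt_min d0 d'0.
exists (m / 2); first by rewrite divr_gt0.
exists (`|qR X t| + `|qI X t| + 1) => x s xX st.
have m2 : m / 2 < m by rewrite ltr_pdivrMr// ltr_pMr ?ltr1n.
have near_d e : m <= e -> ball ((X, t) : R * R) e (x, s).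
  by move=> me; split; rewrite /ball /= distrC;
    apply: le_lt_trans (lt_le_trans m2 me).
have md : m <= d by rewrite ge_min lexx.
have md' : m <= d' by rewrite ge_min lexx orbT.
have hR := Hd (x, s) (near_d d md); have hI := Hd' (x, s) (near_d d' md').
have nR := ler_normB (qR X t) (qR X t - qR x s).
have nI := ler_normB (qI X t) (qI X t - qI x s).
rewrite !subKr in nR nI; rewrite /= in hR hI.
have := normr_ge0 (qR X t); have := normr_ge0 (qI X t) => h1 h2.
split.
  by apply: le_trans nR _; move: hR; rewrite /qR; lra.
by apply: le_trans nI _; move: hI; rewrite /qI; lra.
Qed.

Variable p : 'cV[R]_3.
Let gamma x t := su2_coord (N (x - c0 * t) t) + p.

Lemma col_comb (a b : R) (A : 'M[R]_3) k l i j :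
  (a *: col k A + b *: col l A) i j = a * A i k + b * A i l.
Proof. by rewrite !mxE. Qed.

Lemma h_connection_col0 (A : 'M[R]_3) (w r1 r2 : R) i :
  (A *m h_connection w r1 r2) i i0 = r1 * A i i1 + r2 * A i i2.
Proof. by rewrite mxE ordinal3_sum !mxE /=; ring. Qed.

Lemma Ad_frame_col0_x x t : is_rderive (fun y => col i0 (H y t)) x
  ((2 * qR x t) *: col i1 (H x t) + (2 * qI x t) *: col i2 (H x t)).
Proof.
move=> i j; rewrite (_ : (fun y => _) = fun y => H y t i i0); last first.
  by apply/funext => y; rewrite mxE.
apply: (is_derive_eq (Ad_frame_x x t i i0)).
by rewrite h_connection_col0 col_comb.
Qed.

Lemma translated_curve_x x t :
  is_rderive (fun y => gamma y t) x (col i0 (H (x - c0 * t) t)).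
Proof.
have := is_rderive_shift (eta_coord_x (x - c0 * t) t) => nD i j.
rewrite (_ : (fun y => _) =
  (fun y => su2_coord (N (y - c0 * t) t) i j) + cst (p i j)); last first.
  by apply/funext => y; rewrite mxE.
have := is_deriveD (nD i j) (is_derive_cst (p i j) x 1).
by rewrite addr0.
Qed.

Lemma translated_curve_xx x t :
  is_rderive (fun y => col i0 (H (y - c0 * t) t)) x
    ((2 * qR (x - c0 * t) t) *: col i1 (H (x - c0 * t) t) +
     (2 * qI (x - c0 * t) t) *: col i2 (H (x - c0 * t) t)).
Proof.
exact: (@is_rderive_shift R 3 1 (fun y => col i0 (H y t)) (- (c0 * t)) x _
  (Ad_frame_col0_x (x - c0 * t) t)).
Qed.

Lemma translated_curve_t x t : is_rderive (gamma x) t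
  (qR (x - c0 * t) t *: col i2 (H (x - c0 * t) t) -
   qI (x - c0 * t) t *: col i1 (H (x - c0 * t) t)).
Proof.
move=> i j; set X := x - c0 * t.
have [r r0 [M Mq]] := q_locally_bounded X t.
pose f y s := su2_coord (N y s) i j.
pose g y s := col i0 (H y s) i j.
pose k y s := ((2 * qR y s) *: col i1 (H y s) + (2 * qI y s) *: col i2 (H y s)) i j.
have fD (y s : R) : is_derive y 1 (f ^~ s) (g y s) by exact: eta_coord_x.
have gD (y s : R) : is_derive y 1 (g ^~ s) (k y s) by exact: Ad_frame_col0_x.
have kM (y s : R) : `|y - X| <= r -> `|s - t| <= r -> `|k y s| <= 4 * M.
  move=> yr sr; have [R_M I_M] := Mq y s yr sr; rewrite /k col_comb.
  apply: le_trans (ler_normD _ _) _; rewrite !normrM (ger0_norm (ler0n _ 2)).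
  have := ler_pM (normr_ge0 _) (normr_ge0 _) R_M (Ad_frame_le1 y s i i1).
  have := ler_pM (normr_ge0 _) (normr_ge0 _) I_M (Ad_frame_le1 y s i i2).
  by rewrite !mulr1; lra.
have gc : {for t, continuous (g X)}.
  have := is_derive1_continuous (Ad_frame_t X t i i0).
  by rewrite (_ : g X = fun s => H X s i i0)//; apply/funext => s; rewrite /g mxE.
have := is_derive_oblique (- c0) r0 fD gD kM gc (eta_coord_t X t i j).
have -> : (fun s => f (X + - c0 * (s - t)) s) =
    (fun s => gamma x s i j) - cst (p i j).
  have XE s : X + - c0 * (s - t) = x - c0 * s by rewrite /X; ring.
  by apply/funext => s; rewrite XE fctE [gamma x s i j]mxE addrK.
move=> D; have := is_deriveD D (is_derive_cst (p i j) t 1); rewrite addr0.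
rewrite (_ : _ - cst _ + _ = (fun s => gamma x s i j)); last first.
  by apply/funext => s; rewrite !fctE subrK.
move=> D'; apply: (is_derive_eq D'); rewrite /g.
by move: (H X t) => A; rewrite !mxE; ring.
Qed.

(** With [e_j] the columns of [H] at the shifted point, [gamma_x = e_0] and
    [gamma_xx = 2 Re q e_1 + 2 Im q e_2]. Since [e_0 x e_1 = e_2] and [e_0 x e_2 = - e_1], half the
    cross product is [Re q e_2 - Im q e_1], which is [gamma_t]. *)
Lemma translated_curve_VFE : VFE gamma.
Proof.
have dxE : dx gamma = fun x t => col i0 (H (x - c0 * t) t).
  apply/funext => x; apply/funext => t.
  by have [_] := is_rderive_unfold (translated_curve_x x t).
split=> [x t|x t|x t|x t].
- by have [] := is_rderive_unfold (translated_curve_x x t).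
- by rewrite dxE; have [] := is_rderive_unfold (translated_curve_xx x t).
- by have [] := is_rderive_unfold (translated_curve_t x t).
have [_] := is_rderive_unfold (translated_curve_t x t); rewrite /dt => ->.
rewrite dxE; have [_] := is_rderive_unfold (translated_curve_xx x t).
rewrite /dx => ->; set X := x - c0 * t.
have UU := NLS_frame_unitary X t.
rewrite cross_linear_r (Ad_delta_cross01 UU) (Ad_delta_cross02 UU).
rewrite scalerDr !scalerA scalerN !mulrA.
by rewrite mulVf ?pnatr_eq0// !mul1r.
Qed.

(** * Periodicity in the space variable *)

Section Periodicity.
Variable T : R.
Hypothesis q_periodic : forall t, periodic (fun x => q x t) T.
Hypothesis H_period : H T 0 = H 0 0.

(** The [t]-connection of [H] contains [q_x], so its periodicity is needed along with that of
    [q]. *)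
Lemma cdx_periodic x t : cdx q (x + T) t = cdx q x t.
Proof.
have shiftE (f : R -> R) : (forall y, f (y + T) = f y) -> derive1 f (x + T) = derive1 f x.
  move=> fT; rewrite /derive1 fT.
  rewrite (_ : (fun h => _) = fun h => h^-1 *: (f (h + x) - f x)) //.
  by apply/funext => h; rewrite addrA fT.
by rewrite /cdx /cderive; congr (_ +i* _)%C; apply: shiftE => y; rewrite q_periodic.
Qed.

Lemma Ad_frame_periodic x t : H (x + T) t = H x t.
Proof.
have qT y s : q (y + T) s = q y s by exact: q_periodic.
suff eq1 : H (x + T) t *m (H x t)^T = 1%:M.
  rewrite -[LHS]mulmx1 -(mulmx1C (Ad_frame_orthogonal x t)) mulmxA eq1.
  by rewrite mul1mx.
rewrite (@skew_frames_cst R 3 (H (x + T)) (H x) (fun s =>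
  h_connection (2 * vt x s i0 0) (2 * vt x s i1 0) (2 * vt x s i2 0)) _ _ _ t 0).
- rewrite (@skew_frames_cst R 3 (fun y => H (y + T) 0) (H ^~ 0) (fun y =>
    h_connection c0 (2 * qR y 0) (2 * qI y 0)) _ _ _ x 0) => [|s|s|s].
  + by rewrite add0r H_period.
  + exact: h_connection_skew.
  + have := is_rderive_shift (Ad_frame_x (s + T) 0).
    by rewrite /qR /qI qT.
  + exact: Ad_frame_x.
- by move=> s; exact: h_connection_skew.
- by move=> s; have := Ad_frame_t (x + T) s; rewrite /vt /qR /qI qT cdx_periodic.
- by move=> s; exact: Ad_frame_t.
Qed.

(** The partial derivatives of [eta] involve only [q] and [H], both periodic, so the translate
    differs from [eta] by a constant. Its value at the origin is [N T 0], which makes the hypothesis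
    the closing condition of the curve. *)
Lemma eta_coord_periodic x t : su2_coord (N T 0) = 0 ->
  su2_coord (N (x + T) t) = su2_coord (N x t).
Proof.
move=> NT; have qT y s : q (y + T) s = q y s by exact: q_periodic.
apply/eqP; rewrite -subr_eq0; apply/eqP.
rewrite (@is_rderive_0_cst R 3 1 (fun s => su2_coord (N (x + T) s) - su2_coord (N x s))
  _ t 0); last first.
  move=> s; have := is_rderiveB (eta_coord_t (x + T) s) (eta_coord_t x s).
  by rewrite /qR /qI qT Ad_frame_periodic subrr.
rewrite (@is_rderive_0_cst R 3 1 (fun y => su2_coord (N (y + T) 0) - su2_coord (N y 0))
  _ x 0); last first.
  move=> y; have := is_rderiveB (is_rderive_shift (eta_coord_x (y + T) 0)) (eta_coord_x y 0).
  by rewrite Ad_frame_periodic subrr.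
rewrite add0r NT eta_origin sub0r; apply/eqP; rewrite oppr_eq0; apply/eqP/colP => i.
by case: (ord3P i) => ->; rewrite !mxE.
Qed.

End Periodicity.

End NLSFrame.

(** * Periodic h-frames along the initial curve *)

Section HFrames.
Variable R : realType.

Definition rotation3 (s : R) : 'M[R]_3 := mx_of_rows 3 3
  [:: [:: 1; 0; 0]; [:: 0; cos s; - sin s]; [:: 0; sin s; cos s]].

Lemma diag1_rotation (s : R) : diag1 (rotation s) = rotation3 s.
Proof.
apply/matrixP => i j; rewrite /diag1.
case: (@split_ordP 1 2 i) => k ->; case: (@split_ordP 1 2 j) => l ->.
- apply: etrans (@block_mxEul _ 1 2 1 2 _ _ _ _ _ _) _; by rewrite !mxE (ord1 k) (ord1 l).
- apply: etrans (@block_mxEur _ 1 2 1 2 _ _ _ _ _ _) _; rewrite !mxE (ord1 k).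
  by case: l => [[|[|]]].
- apply: etrans (@block_mxEdl _ 1 2 1 2 _ _ _ _ _ _) _; rewrite !mxE (ord1 l).
  by case: k => [[|[|]]].
- apply: etrans (@block_mxEdr _ 1 2 1 2 _ _ _ _ _ _) _; rewrite !mxE.
  by case: k => [[|[|]]] //; case: l => [[|[|]]].
Qed.

Lemma rotation3D (s t : R) : rotation3 s *m rotation3 t = rotation3 (s + t).
Proof.
apply/matrixP => i j; rewrite [LHS]mxE ordinal3_sum.
by case: (ord3P i) => ->; case: (ord3P j) => ->; rewrite !mxE /= ?cosD ?sinD; ring.
Qed.

Lemma rotation3_0 : rotation3 0 = 1%:M.
Proof.
by apply/matrixP => i j; case: (ord3P i) => ->; case: (ord3P j) => ->;
  rewrite !mxE /= ?cos0 ?sin0 ?oppr0.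
Qed.

Lemma rotation3T (s : R) : (rotation3 s)^T = rotation3 (- s).
Proof.
by apply/matrixP => i j; case: (ord3P i) => ->; case: (ord3P j) => ->;
  rewrite !mxE /= ?cosN ?sinN ?opprK.
Qed.

Lemma rotation3_deriv (c x : R) :
  exists D, is_rderive (fun y => rotation3 (c * y)) x D.
Proof.
have cxD : is_derive x 1 (fun y => c * y) c.
  have := is_deriveZ c (is_derive_id x (1 : R)).
  by rewrite [_ *: 1]mulr1.
have cosD := is_derive1_comp (is_derive_cos (c * x)) cxD.
have sinD := is_derive1_comp (is_derive_sin (c * x)) cxD.
have entry (i j : 'I_3) : derivable (fun y => rotation3 (c * y) i j) x 1.
  have via (g : R -> R) : (forall y, rotation3 (c * y) i j = g y) ->
      derivable g x 1 -> derivable (fun y => rotation3 (c * y) i j) x 1.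
    by move=> /funext ->.
  have vcst a : (forall y, rotation3 (c * y) i j = a) ->
      derivable (fun y => rotation3 (c * y) i j) x 1.
    by move=> /via; apply; exact: derivable_cst.
  have vcos := via (cos \o *%R c) ^~ (@ex_derive _ _ _ _ _ _ _ cosD).
  have vsin := via (sin \o *%R c) ^~ (@ex_derive _ _ _ _ _ _ _ sinD).
  have vsinN := via (- (sin \o *%R c)) ^~ (@ex_derive _ _ _ _ _ _ _ (is_deriveN sinD)).
  move: vcst vcos vsin vsinN {via}.
  (* Each entry is 0, 1, a cosine, a sine or the opposite of a sine; the alternatives are tried in
     turn. *)
  case: (ord3P i) => ->; case: (ord3P j) => -> vcst vcos vsin vsinN;
    by [ apply: (vcst 0) => y; rewrite mxE | apply: (vcst 1) => y; rewrite mxE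
       | apply: vcos => y; rewrite mxE | apply: vsin => y; rewrite mxE
       | apply: vsinN => y; rewrite mxE ].
exists (derive1 (fun y => rotation3 (c * y)) x); apply: derivable_is_rderive.
exact/derivable_mxP.
Qed.

Lemma h_frame_deriv (gamma : R -> 'cV[R]_3) c h x :
  h_frame gamma c h -> derivable h x 1.
Proof.
move=> [e [de _ _ _ _] hE].
have [D rD] := rotation3_deriv c x.
have := is_rderiveM (derivable_is_rderive (de x)) rD.
rewrite (_ : (fun y => e y *m rotation3 (c * y)) = h).
  by case/is_rderive_unfold.
by apply/funext => y; rewrite hE diag1_rotation.
Qed.

Lemma h_frame_orthogonal (gamma : R -> 'cV[R]_3) c h x :
  h_frame gamma c h -> (h x)^T *m h x = 1%:M.
Proof.
move=> [e [_ /(_ x) [ee _] _ _ _] ->].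
rewrite diag1_rotation trmx_mul rotation3T -mulmxA (mulmxA _ (e x)) ee mul1mx.
by rewrite rotation3D addNr rotation3_0.
Qed.

Lemma h_frame_tangent (gamma : R -> 'cV[R]_3) c h x :
  h_frame gamma c h -> col i0 (h x) = derive1 gamma x.
Proof.
move=> [e [_ _ eE _ _] ->]; rewrite -eE diag1_rotation.
apply/colP => i; rewrite [LHS]mxE [LHS]mxE [RHS]mxE ordinal3_sum !mxE /=.
by rewrite mulr1 !mulr0 !addr0.
Qed.

(** The holonomy [R(-2 pi c)] of the p-frame undoes the rotation by [2 pi c] accumulated over one
    period. *)
Lemma h_frame_periodic (gamma : R -> 'cV[R]_3) c h :
  normal_holonomy gamma (rotation (- (2 * pi * c))) -> h_frame gamma c h ->
  h (2 * pi) = h 0.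
Proof.
move=> hol [e pe hE]; rewrite !hE (hol e pe) !diag1_rotation -mulmxA rotation3D.
by congr (_ *m rotation3 _); ring.
Qed.

End HFrames.

Theorem theorem5p6 (R : realType) (c0 : R)
  (gamma0 : R -> 'cV[R]_3)
  (gamma0_smooth : smooth_curve gamma0)
  (gamma0_closed : periodic gamma0 (2 * pi))
  (gamma0_arc : arc_length_param gamma0)
  (gamma0_holonomy : normal_holonomy gamma0 (rotation (- (2 * pi * c0))))
  (h0 : R -> 'M[R]_3) (r1 r2 : R -> R)
  (h0_frame : h_frame gamma0 c0 h0)
  (h0_connection : forall x,
     invmx (h0 x) *m derive1 h0 x = h_connection c0 (r1 x) (r2 x))
  (phi0 : 'M[R[i]]_2)
  (phi0_SU2 : SU2 phi0)
  (phi0_h0 : Ad_delta phi0 = h0 0)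
  (q : R -> R -> R[i])
  (q_smooth : csmooth2 q)
  (q_NLS : NLS q)
  (q_periodic : forall t, periodic (fun x => q x t) (2 * pi))
  (q_init : forall x, q x 0 = 2^-1 * (r1 x +i* r2 x)%C)
  (E : R -> R -> R[i] -> 'M[R[i]]_2)
  (E_frame : NLS_frame q E)
  (E_init : forall lam, E 0 0 lam = phi0) :
  let lam0 : R[i] := (c0 / 2)%:C in
  let gamma := fun x t =>
    su2_coord (eta E lam0 (x - c0 * t) t) + gamma0 0 in
  (forall x t, derivable (E x t : R[i]^o -> 'M[R[i]]_2) lam0 1 /\
     su2 (eta E lam0 x t)) /\
  [/\ VFE gamma,
      forall x, gamma x 0 = gamma0 x
    & forall t, periodic (fun x => gamma x t) (2 * pi)].
Proof.
move=> lam0 gamma.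
pose H x t := Ad_delta (E x t lam0).
have h0_orth x : (h0 x)^T *m h0 x = 1%:M by exact: h_frame_orthogonal h0_frame.
have H00 : H 0 0 = h0 0 by rewrite /H E_init.
have H00_orth : H 0 0 *m (H 0 0)^T = 1%:M by rewrite H00; exact: mulmx1C.
have h0D x : is_rderive h0 x (h0 x *m h_connection c0 (r1 x) (r2 x)).
  have [h0_unit _] := mulmx1_unit (mulmx1C (h0_orth x)).
  have := derivable_is_rderive (@h_frame_deriv _ _ _ _ x h0_frame).
  by rewrite -h0_connection mulmxA mulmxV// mul1mx.
have half : 2^-1 = (2^-1)%:C :> R[i] by rewrite fmorphV rmorph_nat.
have r1E x : 2 * complex.Re (q x 0) = r1 x.
  by rewrite q_init half /=; field.
have r2E x : 2 * complex.Im (q x 0) = r2 x.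
  by rewrite q_init half /=; field.
have H_h0 x : H x 0 = h0 x.
  (* Since [2 q(., 0) = r1 + i r2], the frame [H(., 0)] has exactly the connection of [h0]. *)
  have HD y : is_rderive (H ^~ 0) y (H y 0 *m h_connection c0 (r1 y) (r2 y)).
    by rewrite -r1E -r2E; exact: Ad_frame_x.
  have := skew_frames_cst (fun s => h_connection_skew c0 (r1 s) (r2 s)) HD h0D x 0.
  rewrite H00 (mulmx1C (h0_orth 0)) => eq1.
  by rewrite -[LHS]mulmx1 -(h0_orth x) mulmxA eq1 mul1mx.
(* Both sides vanish at 0, and both have the first column of [H(., 0) = h0], the tangent of
   [gamma0], as derivative. *)
have etaE x : su2_coord (eta E lam0 x 0) = gamma0 x - gamma0 0.
  have gamma0D y : is_rderive gamma0 y (col i0 (H y 0)).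
    rewrite H_h0 (@h_frame_tangent _ _ _ _ y h0_frame).
    exact: derivable_is_rderive (gamma0_smooth 0%N y).
  have nD y := eta_coord_x c0 q_smooth E_frame E_init y 0.
  have diffD y := is_rderiveB (nD y) (gamma0D y).
  have := @is_rderive_0_cst R 3 1 (fun y => su2_coord (eta E lam0 y 0) - gamma0 y) _ x 0.
  rewrite (eta_origin c0 E_init) => cst0.
  have su2_coord0 : su2_coord (0 : 'M[R[i]]_2) = 0.
    by apply/colP => i; case: (ord3P i) => ->; rewrite !mxE.
  rewrite -[LHS](subrK (gamma0 x)) cst0.
    by rewrite su2_coord0 sub0r addrC.
  by move=> y; have := diffD y; rewrite subrr.
split.
  move=> x t; split; last exact: (eta_su2 c0 q_smooth E_frame E_init x t).
  by case: (NLS_frame_derivable c0 q_smooth E_frame E_init x t).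
split.
- exact: (translated_curve_VFE q_smooth E_frame E_init H00_orth (gamma0 0)).
- by move=> x; rewrite /gamma mulr0 subr0 etaE subrK.
move=> t x; rewrite /gamma (_ : x + 2 * pi - c0 * t = x - c0 * t + 2 * pi); last by ring.
(* Two closing conditions at time 0 remain: that of the frame follows from the normal holonomy, that
   of [eta] from [gamma0] being closed. *)
rewrite (eta_coord_periodic q_smooth E_frame E_init H00_orth q_periodic) //.
  rewrite -/lam0; have := H_h0 (2 * pi); rewrite /H => ->.
  by rewrite (h_frame_periodic gamma0_holonomy h0_frame) -H00.
by rewrite etaE -[2 * pi]add0r gamma0_closed subrr.
Qed.
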